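(* Let $k\geq 1$ be an integer and let $G$ be a graph of order $n$. If either (a) $\rho(G)\geq\rho(L_{n,k})$ and $n\geq \max\{6k+11,\frac{(k+3)(k+4)}{2}\}$, or (b) $q(G)\geq q(L_{n,k})$ and $n\geq \max\{6k+11,k^2+2k+3\}$, then $G$ contains a cycle $C_{\ell}$ for each $\ell\in [3,n-k+1]$, unless $G\cong L_{n,k}$.
   Context: $\rho(G)$ is the spectral radius (largest eigenvalue) of the adjacency matrix $A(G)$; $q(G)$ is the signless Laplacian spectral radius, the largest eigenvalue of $Q(G)=A(G)+D(G)$ where $D(G)$ is the diagonal degree matrix. $L_{n,k}:=K_1\vee(K_{n-k-1}+K_k)$, where $+$ denotes disjoint union and $\vee$ denotes join (disjoint union plus all edges between the two parts). *)

(* Defs.v *)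
From HB Require Import structures.
From mathcomp Require Import all_boot all_order all_algebra.
From mathcomp Require Import boolp classical_sets reals.
From mathcomp Require complex.

Set Implicit Arguments.
Unset Strict Implicit.
Unset Printing Implicit Defensive.

Import Order.TTheory GRing.Theory Num.Theory.

Record sgraph := SGraph {
  vertex :> finType;
  adj : rel vertex;
  adj_sym : symmetric adj;
  adj_irr : irreflexive adj }.

Definition sgraph_iso (G H : sgraph) : Prop :=
  exists2 f : G -> H, bijective f & {mono f : x y / adj x y}.

Section GraphOps.

Definition complete_adj n : rel 'I_n := fun i j => i != j.

Lemma complete_sym n : symmetric (@complete_adj n).
Proof. by move=> i j; rewrite /complete_adj eq_sym. Qed.

Lemma complete_irr n : irreflexive (@complete_adj n).
Proof. by move=> i; rewrite /complete_adj eqxx. Qed.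

Definition complete n : sgraph := SGraph (@complete_sym n) (@complete_irr n).

Variables G H : sgraph.

(* Disjoint union for b = false, join for b = true. *)
Definition sum_adj (b : bool) : rel (G + H)%type := fun x y =>
  match x, y with
  | inl u, inl v => adj u v
  | inr u, inr v => adj u v
  | _, _ => b
  end.

Lemma sum_adj_sym b : symmetric (sum_adj b).
Proof. by case=> [u|u] [v|v] //=; apply: adj_sym. Qed.

Lemma sum_adj_irr b : irreflexive (sum_adj b).
Proof. by case=> u /=; apply: adj_irr. Qed.

Definition disjoint_union : sgraph :=
  SGraph (@sum_adj_sym false) (@sum_adj_irr false).

Definition join : sgraph := SGraph (@sum_adj_sym true) (@sum_adj_irr true).

End GraphOps.

Definition Lgraph (n k : nat) : sgraph :=
  join (complete 1) (disjoint_union (complete (n - k - 1)) (complete k)).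

Lemma card_Lgraph n k : k < n -> #|Lgraph n k| = n.
Proof.
by move=> kn; rewrite !card_sum !card_ord -subnDA addn1 addnA add1n
  -subSn // subSS subnK // ltnW.
Qed.

(* Meaningful for l >= 3 only: for l = 2 an edge qualifies, traversed twice. *)
Definition has_cycle (G : sgraph) (l : nat) : Prop :=
  exists2 s : seq G, ucycle (@adj G) s & size s = l.

Definition degree (G : sgraph) (x : G) : nat := #|[set y | adj x y]|.

Local Open Scope ring_scope.

Section Spectra.
Variable R : realType.

(* The set of eigenvalues is finite, and nonempty for a symmetric matrix of
   positive size, so that this supremum is a maximum: see
   [max_eigenvalueP]. *)
Definition max_eigenvalue m (M : 'M[R]_m) : R :=
  sup [set a | eigenvalue M a]%classic.

Definition adjacency_mx (G : sgraph) : 'M[R]_#|G| :=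
  \matrix_(i, j) (adj (enum_val i) (enum_val j))%:R.

Definition degree_mx (G : sgraph) : 'M[R]_#|G| :=
  diag_mx (\row_i (degree (enum_val i))%:R).

Definition signless_laplacian (G : sgraph) : 'M[R]_#|G| :=
  adjacency_mx G + degree_mx G.

Definition spectral_radius (G : sgraph) : R :=
  max_eigenvalue (adjacency_mx G).

Definition signless_spectral_radius (G : sgraph) : R :=
  max_eigenvalue (signless_laplacian G).

Section MaxEigenvalue.
Import complex.

Lemma sym_has_eigenvalue m (M : 'M[R]_m) :
  (0 < m)%N -> M^T = M -> exists a, eigenvalue M a.
Proof.
case: m M => // m M _ Msym.
pose f := real_complex R; pose N := map_mx f M.
have Nh : N \is hermsymmx.
  apply: realsym_hermsym.
    apply/is_hermitianmxP; rewrite expr0 scale1r map_mx_id //.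
    by apply/matrixP => i j; rewrite !mxE -{1}Msym mxE.
  apply/mxOverP => i j; rewrite mxE; apply/complex_realP; by exists (M i j).
have := hermitian_spectral_diag_real Nh.
have /orthomx_spectralP := hermitian_normalmx Nh.
set P := spectralmx N; set d := spectral_diag N => defN dR.
have Pu : P \in unitmx by apply: spectral_unit.
exists (Re (d 0 0)).
rewrite -(eigenvalue_map f) /f /=.
rewrite RRe_real; last by move/mxOverP: dR; apply.
apply/eigenvalueP; exists (row 0 P).
  rewrite -/N {1}defN !mulmxA -row_mul mulmxV // -row_mul mul1mx.
  by rewrite row_diag_mx -scalemxAl -rowE.
apply/eqP => P0; move: Pu; rewrite -row_free_unit => /row_freeP[B PB].
have := congr1 (fun X => row 0 X 0 0) PB.
by rewrite row_mul P0 mul0mx !mxE eqxx => /eqP; rewrite eq_sym oner_eq0.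
Qed.

End MaxEigenvalue.

Lemma max_eigenvalueP m (M : 'M[R]_m) : (0 < m)%N -> M^T = M ->
  eigenvalue M (max_eigenvalue M) /\
  forall a, eigenvalue M a -> a <= max_eigenvalue M.
Proof.
move=> m0 Msym; have [a0 a0P] := sym_has_eigenvalue m0 Msym.
have chi0 : char_poly M != 0 by rewrite monic_neq0 ?char_poly_monic.
suff [b bP bmax] : exists2 b, eigenvalue M b &
    forall a, eigenvalue M a -> a <= b.
  suff -> : max_eigenvalue M = b by [].
  apply/eqP; rewrite eq_le; apply/andP; split.
    by apply: ge_sup => //; exists a0.
  by apply: ub_le_sup => //; exists b.
apply: contrapT => noMax.
have step a : eigenvalue M a -> exists2 b, eigenvalue M b & a < b.
  move=> aP; apply: contrapT => nb; apply: noMax; exists a => // c cP.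
  by rewrite leNgt; apply/negP => ac; apply: nb; exists c.
have chain q : exists s, [/\ size s = q.+1, all (eigenvalue M) s
    & sorted >%R s].
  elim: q => [|q [[|x s] [sz al so]]] //.
    by exists [:: a0]; rewrite /= a0P.
  have /step[b bP xb] : eigenvalue M x by case/andP: al.
  by exists (b :: x :: s); split; rewrite /= ?xb ?bP //; case: sz => ->.
have [s [sz al so]] := chain (size (char_poly M)).
have su : uniq s by apply: sorted_uniq so; [exact: rev_trans lt_trans | exact: ltxx].
have : (size s < size (char_poly M))%N.
  apply: max_poly_roots => //; apply/allP => x /(allP al).
  by rewrite eigenvalue_root_char.
by rewrite sz ltnNge leqnSn.
Qed.

Lemma adjacency_mx_sym (G : sgraph) : (adjacency_mx G)^T = adjacency_mx G.
Proof. by apply/matrixP=> i j; rewrite !mxE adj_sym. Qed.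

Lemma signless_laplacian_sym (G : sgraph) :
  (signless_laplacian G)^T = signless_laplacian G.
Proof.
by rewrite /signless_laplacian linearD /= adjacency_mx_sym /degree_mx tr_diag_mx.
Qed.

End Spectra.

(* Main.v *)
Require Import Defs.
From mathcomp Require Import all_boot all_order all_algebra boolp reals.
From mathcomp Require Import zify ring lra.
From mathcomp Require complex.

Set Implicit Arguments.
Unset Strict Implicit.
Unset Printing Implicit Defensive.

Import Order.TTheory GRing.Theory Num.Theory.

(* A lower bound on either spectral radius forces few nonadjacent pairs. With m edges,
   rho^2 n <= 2 m (n - 1) and q (n - 1) <= 2 m + (n - 1) (n - 2), while L_{n,k} contains
   K_{n-k}, so that rho >= n - k - 1 and q > 2 (n - k - 1).

   Among the sets of n - k + 1 vertices let W span the most edges. If W satisfies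
   Posa's degree condition, it has a spanning cycle, and by Bondy's argument cycles of
   all shorter lengths. Otherwise some i < |W| / 2 has i vertices of degree at most i
   in W; as W is extremal, every vertex outside W then has at most i + 1 neighbours
   in W. For i >= 2 this gives too many nonadjacent pairs. For i = 1, removing the
   vertex of degree at most 1 leaves a set H of n - k vertices such that every vertex
   outside H has at most one neighbour in H.

   In that case let x be a nonnegative top eigenvector of G and a the vertex of H where
   x is largest. Completing H and its complement to cliques and moving all edges
   between them to a turns G into L_{n,k} without decreasing the quadratic form at x.
   The spectral hypothesis forces equality, so x is an eigenvector of L_{n,k}, hence
   positive, so H and its complement are cliques and each outer vertex has exactly one
   neighbour in H. If these neighbours agree, G is L_{n,k}; if not, two outer vertices
   give a detour through two vertices of H and all cycle lengths appear. *)

(** * Spanning cycles *)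

Section SequencesAsPaths.
Variables (T : eqType) (e : rel T).
Implicit Types (x y u : T) (p q s : seq T).

Lemma complete_cycle s : 1 < size s -> uniq s ->
  {in s &, forall x y, x != y -> e x y} -> cycle e s.
Proof.
case: s => [|x [|y s]] // _ us es /=.
have /= /andP[-> /=] : sorted e [:: x, y & s].
  apply: pairwise_sorted; move: us; rewrite uniq_pairwise.
  apply: (@sub_in_pairwise _ (mem [:: x, y & s])); last exact/allP.
  by move=> a b ai bi /= ab; apply: es.
rewrite rcons_path => -> /=; apply: es.
- by rewrite inE mem_last orbT.
- by rewrite inE eqxx.
by move/andP: us => [+ _]; apply: contraNneq => <-; rewrite mem_last.
Qed.

Lemma prev_head x q : uniq (x :: q) -> prev (x :: q) x = last x q.
Proof.
move=> /andP[xq _]; rewrite prev_nth mem_head (last_nth x).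
by have /eqP <- : index x q == size q by rewrite eqn_leq index_size leqNgt index_mem.
Qed.

Lemma next_split u x q : uniq (u :: q) -> x \in u :: q -> x != last u q ->
  exists q1 q2, q = q1 ++ next (u :: q) x :: q2 /\ last u q1 = x.
Proof.
move=> uq xi xl; set i := index x (u :: q).
have iq : i < size q.
  have : i < (size q).+1 by move: xi; rewrite -index_mem.
  rewrite ltnS leq_eqVlt => /orP[/eqP iE|//].
  by move: xl; rewrite (last_nth u) -iE nth_index ?eqxx.
exists (take i q), (drop i.+1 q); split.
  by rewrite next_nth xi -drop_nth // cat_take_drop.
by rewrite (last_nth u) size_takel 1?ltnW // -[u :: take i q]/(take i.+1 (u :: q))
  nth_take // nth_index.
Qed.

Lemma crossing_cycle u y q1 q2 : symmetric e ->
    path e u q1 -> path e y q2 -> e u y -> e (last y q2) (last u q1) ->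
  cycle e (u :: q1 ++ rev (y :: q2)).
Proof.
move=> esym p1 p2 uy cr /=; rewrite rcons_cat cat_path p1 /= -rev_cons.
have := rev_path e u (rcons (y :: q2) (last u q1)).
rewrite last_rcons belast_rcons => ->.
by rewrite (eq_path (e' := e)) ?rcons_path /= ?uy ?p2 // => a b; rewrite esym.
Qed.

Definition add_edge u v : rel T := fun x y =>
  [|| e x y, (x == u) && (y == v) | (x == v) && (y == u)].

Lemma add_edgeC u v : add_edge u v =2 add_edge v u.
Proof. by move=> x y; rewrite /add_edge [X in _ || X]orbC. Qed.

Lemma sub_add_edge u v : subrel e (add_edge u v).
Proof. by move=> x y exy; rewrite /add_edge exy. Qed.

Lemma add_edge_sym u v : symmetric e -> symmetric (add_edge u v).
Proof.
move=> esym x y; rewrite /add_edge esym; congr (_ || _).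
by rewrite orbC; congr (_ || _); rewrite andbC.
Qed.

Lemma add_edge_irr u v : u != v -> irreflexive e -> irreflexive (add_edge u v).
Proof.
move=> uv eirr x; rewrite /add_edge eirr /=; have [->|] := eqVneq x u.
  by rewrite (negPf uv).
by rewrite andbF.
Qed.

Lemma path_add_edge_ends x q : uniq (x :: q) -> 1 < size q ->
  path (add_edge x (last x q)) x q -> path e x q.
Proof.
move=> uq q1 /(pathP x) pq; apply/(pathP x) => i iq.
have nthI j l : j <= size q -> l <= size q ->
    nth x (x :: q) j = nth x (x :: q) l -> j = l.
  by move=> jq lq /eqP; rewrite nth_uniq ?ltnS // => /eqP.
case/or3P: (pq i iq) => [//|/andP[/eqP iE /eqP i1E]|/andP[/eqP iE _]].
  have i0 : i = 0 by apply: nthI => //; apply: ltnW.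
  have : i.+1 = size q by apply: nthI; rewrite // -last_nth.
  by lia.
have : i = size q by apply: nthI; rewrite -?last_nth // ltnW.
by lia.
Qed.

End SequencesAsPaths.

Section SpanningCycles.
Variable T : finType.
Implicit Types (e : rel T) (W : {set T}).

Definition has_ucycle e l := exists2 s, ucycle e s & size s = l.

Definition spanning_cycle e W := exists2 s, ucycle e s & s =i W.

Definition spanning_path e W u v :=
  exists q, [/\ path e u q, last u q = v, uniq (u :: q) & u :: q =i W].

Definition deg_in e W x := #|[set y in W | e x y]|.

Definition nonadj e : rel T := fun x y => (x != y) && ~~ e x y.

Definition clique e W := {in W &, forall x y, x != y -> e x y}.

Definition posa_obstruction e W i :=
  [/\ 0 < i, i.*2 < #|W| & i <= #|[set x in W | deg_in e W x <= i]|].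

Lemma nonadj_sym e : symmetric e -> symmetric (nonadj e).
Proof. by move=> esym x y; rewrite /nonadj eq_sym esym. Qed.

Lemma nonadj_irr e : irreflexive (nonadj e).
Proof. by move=> x; rewrite /nonadj eqxx. Qed.

Lemma deg_in_subrel e e' W x : subrel e e' -> deg_in e W x <= deg_in e' W x.
Proof.
by move=> ee; apply/subset_leq_card/subsetP => y; rewrite !inE => /andP[-> /ee].
Qed.

Lemma posa_obstruction_subrel e e' W i : subrel e e' ->
  posa_obstruction e' W i -> posa_obstruction e W i.
Proof.
move=> ee [i0 i2 iA]; split=> //; apply: leq_trans iA _.
apply/subset_leq_card/subsetP => x; rewrite !inE => /andP[-> /=].
exact/leq_trans/deg_in_subrel.
Qed.

Lemma spanning_path_sym e W u v : symmetric e ->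
  spanning_path e W u v -> spanning_path e W v u.
Proof.
move=> esym [q [pq lq uq qW]].
have revE : v :: rev (belast u q) = rev (u :: q) by rewrite [u :: q]lastI rev_rcons lq.
exists (rev (belast u q)); split.
- by rewrite -lq rev_path -(eq_path (e := e)) // => a b; rewrite esym.
- by rewrite -[last v _]/(last v (v :: rev (belast u q))) revE rev_cons last_rcons.
- by rewrite revE rev_uniq.
- by move=> x; rewrite revE mem_rev qW.
Qed.

(* An added edge that the cycle uses is opened to leave a spanning path. *)
Lemma spanning_cycle_add_edge e W u v : symmetric e -> 2 < #|W| ->
  spanning_cycle (add_edge e u v) W -> spanning_cycle e W \/ spanning_path e W u v.
Proof.
move=> esym W3 [s /andP[cs us] sW].
have [/allP es|/allPn[z zs nez]] := boolP (all (fun x => e x (next s x)) s).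
  by left; exists s; rewrite // /ucycle us andbT; apply: cycle_from_next.
right; pose y := next s z; have ys : y \in s by rewrite mem_next.
have [i q qE] := rot_to ys.
have uq : uniq (y :: q) by rewrite -qE rot_uniq.
have qW : y :: q =i W by move=> x; rewrite -qE mem_rot sW.
have lq : last y q = z by rewrite -prev_head // -qE prev_rot // prev_next.
have q1 : 1 < size q by rewrite -ltnS -(eq_card qW) (card_uniqP uq) in W3 *.
have pq : path (add_edge e u v) y q.
  have : cycle (add_edge e u v) (y :: q) by rewrite -qE rot_cycle.
  by rewrite /= rcons_path => /andP[].
have := next_cycle cs zs; rewrite {1}/add_edge (negPf nez) -/y /=.
case/orP => /andP[/eqP zE /eqP yE]; rewrite -zE -yE in pq *.
  apply: spanning_path_sym => //; exists q; split=> //.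
  by apply: path_add_edge_ends => //; rewrite lq (eq_path (add_edgeC e y z)).
by exists q; split=> //; apply: path_add_edge_ends; rewrite ?lq.
Qed.

Lemma crossing_spanning_cycle e W u x q : symmetric e ->
    path e u q -> uniq (u :: q) -> u :: q =i W -> x \in W -> x != last u q ->
    e u (next (u :: q) x) -> e (last u q) x ->
  spanning_cycle e W.
Proof.
move=> esym pq uq qW xW xl; rewrite -qW in xW.
have [q1 [q2 []]] := next_split uq xW xl.
move: (next (u :: q) x) => y qE lx uy; rewrite qE last_cat /= => vx.
exists (u :: q1 ++ rev (y :: q2)); last first.
  by move=> z; rewrite -qW qE !inE !mem_cat mem_rev.
move: pq; rewrite qE cat_path /= => /and3P[pq1 _ pq2].
rewrite /ucycle crossing_cycle ?lx //.
by move: uq; rewrite qE !cons_uniq !mem_cat mem_rev !cat_uniq rev_uniq has_rev.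
Qed.

Lemma card_next_nbrs e W s y : uniq s -> s =i W ->
  #|[set x in W | e y (next s x)]| = deg_in e W y.
Proof.
move=> us sW; rewrite -(card_imset _ (can_inj (prev_next us))).
apply: eq_card => x; apply/imsetP/idP => [[z]|].
  by rewrite !inE => /andP[zW yz] ->; rewrite -sW mem_next sW zW.
rewrite inE => /andP[xW yx]; exists (prev s x); last by rewrite next_prev.
by rewrite inE -sW mem_prev sW xW next_prev.
Qed.

(* If no crossing pair closes the path, the predecessors of the neighbours of u are
   not adjacent to v: there are as many of them as the degree of u, and each has
   degree at most that of u. *)
Lemma spanning_path_cycle_or_obstruction e W u v : symmetric e -> irreflexive e ->
    spanning_path e W u v -> u != v -> deg_in e W u <= deg_in e W v ->
    {in W, forall x, nonadj e x v -> deg_in e W x <= deg_in e W u} ->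
  spanning_cycle e W \/ posa_obstruction e W (deg_in e W u).
Proof.
move=> esym eirr [q [pq lq uq qW]] uv duv maxu.
pose P := [set x in W | e u (next (u :: q) x)].
have cP : #|P| = deg_in e W u by apply: card_next_nbrs.
have vW : v \in W by rewrite -qW -lq mem_last.
have vP : v \notin P.
  have <- : prev (u :: q) u = v by rewrite prev_head.
  by rewrite inE next_prev // eirr andbF.
have [/exists_inP[x xP vx]|/exists_inPn noX] := boolP [exists x in P, e v x].
  left; move: (xP); rewrite inE => /andP[xW ux].
  apply: (crossing_spanning_cycle esym pq uq qW xW); rewrite ?lq //.
  by apply: contraNneq vP => <-.
right; split.
- apply/card_gt0P; case: (q) pq lq qW => [|y q'] /=.
    by move=> _ /eqP; rewrite (negPf uv).
  by move=> /andP[uy _] _ qW'; exists y; rewrite inE uy -qW' !inE eqxx orbT.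
- suff : deg_in e W u + deg_in e W v < #|W| by lia.
  rewrite -cP (cardsD1 v W) vW add1n ltnS -cardsUI.
  have /eqP -> : P :&: [set x in W | e v x] == set0.
    by apply/eqP/setP => x; rewrite in_set0 in_setI;
      apply/andP => -[/noX/negPf xv]; rewrite inE xv andbF.
  rewrite cards0 addn0; apply/subset_leq_card/subsetP => x; rewrite !inE.
  have [->|_ /orP[]/andP[]//] := eqVneq x v.
  by move: vP; rewrite inE => /negPf ->; rewrite eirr andbF.
- rewrite -{1}cP; apply/subset_leq_card/subsetP => x xP.
  have xW : x \in W by move: xP; rewrite inE => /andP[].
  rewrite inE xW maxu // /nonadj esym noX // andbT.
  by apply: contraNneq vP => <-.
Qed.

Lemma clique_spanning_cycle e W : 1 < #|W| -> clique e W -> spanning_cycle e W.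
Proof.
move=> W1 cW; exists (enum W); last exact: mem_enum.
rewrite /ucycle enum_uniq andbT; apply: complete_cycle; rewrite ?enum_uniq -?cardE //.
by move=> x y; rewrite !mem_enum; apply: cW.
Qed.

Lemma clique_or_max_nonadj e W : symmetric e -> clique e W \/
  exists u v, [/\ u \in W, v \in W, nonadj e u v, deg_in e W u <= deg_in e W v
    & {in W, forall x, nonadj e x v -> deg_in e W x <= deg_in e W u}].
Proof.
move=> esym; pose nbr v := [exists x in W, nonadj e x v].
have [/forall_inP all_adj|] := boolP [forall v in W, ~~ nbr v].
  left=> x y xW yW xy; apply: contraNT (all_adj y yW) => nxy.
  by apply/exists_inP; exists x => //; rewrite /nonadj xy.
rewrite negb_forall_in => /exists_inP[v0 v0W /negPn nv0]; right.
have [v /andP[vW nv] vmax] :=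
  @arg_maxnP _ v0 (fun v => (v \in W) && nbr v) (deg_in e W) (introT andP (conj v0W nv0)).
have [u0 u0W nu0] := exists_inP nv.
have [u /andP[uW nu] umax] := @arg_maxnP _ u0
  (fun u => (u \in W) && nonadj e u v) (deg_in e W) (introT andP (conj u0W nu0)).
exists u, v; split=> // [|x xW nx]; last by apply: umax; rewrite /= xW.
by apply: vmax; rewrite /= uW; apply/exists_inP; exists v; rewrite // nonadj_sym.
Qed.

(* Posa's theorem, by induction on the number of missing edges: the edge added is one
   whose ends have maximal degrees. *)
Theorem posa e W : symmetric e -> irreflexive e -> 2 < #|W| ->
  spanning_cycle e W \/ exists i, posa_obstruction e W i.
Proof.
pose gaps e := [set p | [&& p.1 \in W, p.2 \in W & nonadj e p.1 p.2]].
have [N] := ubnP #|gaps e|; elim: N e => // N IH e gapsN esym eirr W3.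
have [cW|[u [v [uW vW nuv duv umax]]]] := clique_or_max_nonadj W esym.
  by left; apply: clique_spanning_cycle => //; apply: ltnW.
have uv : u != v by case/andP: nuv.
have [|c|[i]] := IH (add_edge e u v) _ (add_edge_sym _ _ esym) (add_edge_irr uv eirr) W3.
- rewrite -ltnS; apply: leq_trans gapsN; rewrite ltnS; apply/proper_card/properP; split.
    apply/subsetP => p; rewrite !inE /nonadj => /and4P[-> -> -> /=].
    exact/contraNN/sub_add_edge.
  by exists (u, v); rewrite inE /= uW vW /nonadj /add_edge ?uv ?(andP nuv).2 ?eqxx ?orbT.
- have [|path_uv] := spanning_cycle_add_edge esym W3 c; first by left.
  have [|obs] := spanning_path_cycle_or_obstruction esym eirr path_uv uv duv umax.
    by left.
  by right; exists (deg_in e W u).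
by move=> obs; right; exists i; apply: posa_obstruction_subrel obs; apply: sub_add_edge.
Qed.

End SpanningCycles.

(** * Pancyclicity *)

Section Pancyclicity.
Variables (T : finType) (e : rel T).
Hypotheses (esym : symmetric e) (eirr : irreflexive e).
Implicit Types (x y z : T) (r s : seq T) (W : {set T}).

Lemma card_inj_meet (I : finType) (f : I -> I) (A B : {set I}) : injective f ->
  #|I| < #|A| + #|B| -> exists2 i, i \in A & f i \in B.
Proof.
move=> finj; rewrite -(card_preimset B finj) -cardsUI => AB.
have /card_gt0P[i] : 0 < #|A :&: f @^-1: B| by have := max_card (A :|: f @^-1: B); lia.
by rewrite !inE => /andP[iA iB]; exists i.
Qed.

Lemma short_chords_cycle x z r i j : uniq (x :: rcons r z) ->
    path e x (rcons r z) -> e z x -> i <= j < size r ->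
    e x (nth x r i) -> e z (nth x r j) ->
  has_ucycle e (j - i + 3).
Proof.
move=> us ps zx /andP[ij jr] xi zj.
pose sl := take (j - i) (drop i.+1 r).
have szl : size sl = j - i by rewrite size_takel // size_drop; lia.
have rE : r = take i r ++ nth x r i :: sl ++ drop (j - i) (drop i.+1 r).
  by rewrite cat_take_drop -drop_nth ?cat_take_drop //; lia.
have lsl : last (nth x r i) sl = nth x r j.
  rewrite (last_nth x) szl -[_ :: sl]/(take (j - i).+1 (nth x r i :: drop i.+1 r)).
  by rewrite nth_take // -drop_nth ?nth_drop ?subnKC //; lia.
exists (x :: nth x r i :: rcons sl z); last by rewrite /= size_rcons szl; lia.
apply/andP; split.
  rewrite /= xi !rcons_path last_rcons lsl zx andbT [e _ z]esym zj andbT.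
  move: ps; rewrite rcons_path {1}rE cat_path /= => /andP[/and3P[_ _]].
  by rewrite cat_path => /andP[].
apply: subseq_uniq us; rewrite /= eqxx {2}rE rcons_cat.
rewrite -[X in subseq X _]cat0s; apply: cat_subseq; first exact: sub0seq.
rewrite /= eqxx rcons_cat -cats1; apply: cat_subseq => //.
by rewrite sub1seq mem_rcons mem_head.
Qed.

Lemma long_chords_cycle x z r i j : uniq (x :: rcons r z) ->
    path e x (rcons r z) -> j < i < size r ->
    e x (nth x r i) -> e z (nth x r j) ->
  has_ucycle e (j + size r - i + 3).
Proof.
move=> us ps /andP[ji ir] xi zj.
have jr := ltn_trans ji ir.
have dropE : rcons (drop i r) z = nth x r i :: rcons (drop i.+1 r) z.
  by rewrite (drop_nth x).
exists (x :: take j.+1 r ++ rev (rcons (drop i r) z)); last first.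
  by rewrite /= size_cat size_rev size_rcons size_takel // size_drop; lia.
have rE : rcons r z = take j.+1 r ++ rcons (drop j.+1 r) z.
  by rewrite -rcons_cat cat_take_drop.
apply/andP; split.
  rewrite dropE crossing_cycle //.
  - by move: ps; rewrite rE cat_path => /andP[].
  - move: ps; rewrite -{1}(cat_take_drop i r) rcons_cat cat_path dropE /=.
    by case/and3P.
  - by rewrite last_rcons (last_nth x) size_takel // -[x :: _]/(take j.+2 (x :: r))
      nth_take.
rewrite -(perm_uniq (s1 := x :: take j.+1 r ++ rcons (drop i r) z)); last first.
  by rewrite perm_cons perm_cat2l perm_sym perm_rev.
apply: subseq_uniq us; rewrite /= eqxx rE; apply: cat_subseq => //.
have -> : drop i r = drop (i - j.+1) (drop j.+1 r) by rewrite drop_drop subnK.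
by rewrite -!cats1; apply: cat_subseq => //; apply: drop_subseq.
Qed.

Definition nbr_positions x0 r y := [set j : 'I_(size r) | e y (nth x0 r j)].

(* Chords from x to r_i and from z to r_j give a cycle of length l as soon as i is
   j - (l - 3) modulo the size of r. *)
Lemma chords_pancyclic x z r l : uniq (x :: rcons r z) ->
    path e x (rcons r z) -> e z x ->
    size r < #|nbr_positions x r x| + #|nbr_positions x r z| ->
    3 <= l <= size r + 2 ->
  has_ucycle e l.
Proof.
move=> us ps zx many lr; pose c := l - 3; pose p := size r.
have shift_lt (j : 'I_p) : (if c <= j then j - c else j + p - c) < p.
  by have := ltn_ord j; case: (leqP c j); lia.
pose shift j := Ordinal (shift_lt j).
have shift_inj : injective shift.
  move=> i j /(congr1 val) /= ij; apply: val_inj => /=.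
  have := ltn_ord i; have := ltn_ord j; move: ij.
  by case: (leqP c i); case: (leqP c j); rewrite /c; lia.
have [|j] := card_inj_meet (A := nbr_positions x r z) (B := nbr_positions x r x) shift_inj.
  by rewrite card_ord addnC.
rewrite !inE /= => zj; have jp := ltn_ord j; case: (leqP c j) => cj xj.
  have -> : l = j - (j - c) + 3 by rewrite /c in cj *; lia.
  by apply: short_chords_cycle xj zj => //; rewrite leq_subr.
have -> : l = j + size r - (j + p - c) + 3 by rewrite /c /p in cj *; lia.
by apply: long_chords_cycle xj zj => //; rewrite /c /p in cj *; lia.
Qed.

Lemma deg_in_nbr_positions W x z r y : x :: rcons r z =i W -> y \in [:: x; z] ->
  deg_in e W y <= #|nbr_positions x r y|.+1.
Proof.
move=> rW; rewrite !inE => yxz.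
pose w := if y == x then z else x.
apply: leq_trans (_ : #|w |: [set nth x r (j : 'I__) | j in nbr_positions x r y]| <= _).
  apply/subset_leq_card/subsetP => v; rewrite !inE -rW inE mem_rcons inE => /andP[+ yv].
  have vy : v != y by apply: contraTneq yv => ->; rewrite eirr.
  case/or3P=> [/eqP vE|/eqP vE|vr]; rewrite ?vE in yv vy *.
  - by rewrite /w [y == x]eq_sym (negPf vy) eqxx.
  - by move: yxz; rewrite /w [y == z]eq_sym (negPf vy) orbF => ->; rewrite eqxx.
  have vp : index v r < size r by rewrite index_mem.
  by apply/orP; right; apply/imsetP; exists (Ordinal vp); rewrite ?inE /= nth_index.
apply: leq_trans (leq_card_setU _ _) _.
by rewrite cards1 add1n ltnS leq_imset_card.
Qed.

Lemma exists_large_consecutive (f : T -> nat) s W : uniq s -> s =i W ->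
  #|W| ^ 2 < 2 * \sum_(x in W) f x -> exists2 x, x \in W & #|W| < f x + f (prev s x).
Proof.
move=> us sW large; apply/exists_inP; apply: contraLR large.
rewrite negb_exists_in -leqNgt => /forall_inP small.
have -> : 2 * \sum_(x in W) f x = \sum_(x in W) (f x + f (prev s x)).
  rewrite big_split mul2n -addnn /=; congr (_ + _).
  rewrite (reindex_inj (can_inj (next_prev us))) /=.
  by apply: eq_bigl => x; rewrite -!sW mem_prev.
rewrite -mulnn -sum_nat_const; apply: leq_sum => x xW.
by rewrite leqNgt small.
Qed.

Lemma ucycle_open s x : 1 < size s -> ucycle e s -> x \in s ->
  exists r : seq T, [/\ uniq (x :: rcons r (prev s x)), x :: rcons r (prev s x) =i s,
    path e x (rcons r (prev s x)) & e (prev s x) x].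
Proof.
move=> s1 /andP[cs us] xs; have zx := prev_cycle cs xs; have [i q qE] := rot_to xs.
have uq : uniq (x :: q) by rewrite -qE rot_uniq.
have qs : x :: q =i s by move=> y; rewrite -qE mem_rot.
have pq : path e x q.
  have : cycle e (x :: q) by rewrite -qE rot_cycle.
  by rewrite /= rcons_path => /andP[].
have lq : last x q = prev s x by rewrite -(prev_rot i us) qE prev_head.
case/lastP: q => [|r z] in qE uq qs pq lq *.
  by move: s1; rewrite -(size_rot i) qE.
by exists r; rewrite -lq last_rcons; split; rewrite // -lq last_rcons in zx.
Qed.

(* Bondy's argument: two consecutive vertices of the spanning cycle have degree sum
   larger than its length. *)
Theorem pancyclic W l : spanning_cycle e W ->
  #|W| ^ 2 < 2 * \sum_(x in W) deg_in e W x -> 3 <= l <= #|W| -> has_ucycle e l.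
Proof.
move=> [s cs sW] many lW; have us := ucycle_uniq cs.
have [x xW large] := exists_large_consecutive us sW many.
have sz : size s = #|W| by rewrite -(eq_card sW) (card_uniqP us).
have [||r [ur rs pr zx]] := @ucycle_open s x _ cs _; [by rewrite sz; lia|by rewrite sW|].
have rW : x :: rcons r (prev s x) =i W by move=> y; rewrite rs sW.
have szr : size r + 2 = #|W|.
  by rewrite -(eq_card rW) (card_uniqP ur) /= size_rcons addn2.
apply: (chords_pancyclic ur pr zx); last by lia.
have := deg_in_nbr_positions rW (mem_head x [:: prev s x]).
have := deg_in_nbr_positions rW (mem_last x [:: prev s x]).
by rewrite /=; lia.
Qed.

End Pancyclicity.

(** * Counting nonadjacent pairs *)

Section PairCounts.
Variable T : finType.
Implicit Types (r e : rel T) (A W X Y : {set T}).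

Lemma deg_inE r W x : deg_in r W x = \sum_(y in W) r x y.
Proof.
rewrite /deg_in -sum1_card big_mkcond [RHS]big_mkcond; apply: eq_bigr => y _.
by rewrite inE; case: (y \in W); case: (r x y).
Qed.

Lemma deg_in_setID r A W x : A \subset W ->
  deg_in r W x = deg_in r A x + deg_in r (W :\: A) x.
Proof. by move=> AW; rewrite !deg_inE (big_setID A) /= (setIidPr AW). Qed.

Lemma deg_inD1 r W a x : a \in W -> deg_in r W x = r x a + deg_in r (W :\ a) x.
Proof. by move=> aW; rewrite !deg_inE (big_setD1 a). Qed.

Lemma deg_in_le r X Y x : X \subset Y -> deg_in r X x <= deg_in r Y x.
Proof. by move=> XY; rewrite (deg_in_setID r x XY) leq_addr. Qed.

Lemma deg_in_nonadj e W x : irreflexive e ->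
  deg_in e W x + deg_in (nonadj e) W x + (x \in W) = #|W|.
Proof.
move=> eirr; have -> : (x \in W : nat) = deg_in eq_op W x.
  rewrite /deg_in; have [xW|xW] := boolP (x \in W).
    apply/esym/eqP/cards1P; exists x; apply/setP => y.
    by rewrite !inE [y == x]eq_sym; case: eqP => [<-|_]; rewrite ?xW ?andbF.
  apply/esym/eq_card0 => y; rewrite !inE.
  by apply/andP => -[yW /eqP xy]; rewrite xy yW in xW.
rewrite !deg_inE -sum1_card -!big_split; apply: eq_bigr => y _ /=; rewrite /nonadj.
by have [->|] := eqVneq x y; rewrite ?eirr //=; case: (e x y).
Qed.

Definition pairs r X Y := \sum_(x in X) deg_in r Y x.

Lemma pairsC r X Y : symmetric r -> pairs r X Y = pairs r Y X.
Proof.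
move=> rsym; rewrite /pairs; under eq_bigr do rewrite deg_inE.
rewrite exchange_big; apply: eq_bigr => y _; rewrite deg_inE.
by apply: eq_bigr => x _; rewrite rsym.
Qed.

Lemma pairs_setIDr r X A W : A \subset W ->
  pairs r X W = pairs r X A + pairs r X (W :\: A).
Proof.
by move=> AW; rewrite /pairs -big_split; apply: eq_bigr => x _ /=; apply: deg_in_setID.
Qed.

Lemma pairs_setID r A W : symmetric r -> A \subset W ->
  pairs r W W = pairs r A A + 2 * pairs r A (W :\: A) + pairs r (W :\: A) (W :\: A).
Proof.
move=> rsym AW; rewrite (pairs_setIDr r W AW) !(pairsC W) // !(pairs_setIDr r _ AW).
by rewrite (pairsC (W :\: A) A) // mul2n -addnn !addnA.
Qed.

Lemma pairs_ge r X Y d : {in X, forall x, d <= deg_in r Y x} -> #|X| * d <= pairs r X Y.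
Proof. by move=> dX; rewrite -sum_nat_const; apply: leq_sum. Qed.

Lemma pairs_le r X Y d : {in X, forall x, deg_in r Y x <= d} -> pairs r X Y <= #|X| * d.
Proof. by move=> dX; rewrite -sum_nat_const; apply: leq_sum. Qed.

Lemma pairs_self_le r A : irreflexive r -> pairs r A A <= #|A| * #|A|.-1.
Proof.
move=> rirr; apply: pairs_le => x xA.
by have := deg_in_nonadj A x rirr; rewrite xA; lia.
Qed.

Lemma pairs_clique e A : irreflexive e -> clique e A -> pairs e A A = #|A| * #|A|.-1.
Proof.
move=> eirr cA; rewrite -sum_nat_const; apply: eq_bigr => x xA.
have := deg_in_nonadj A x eirr; rewrite xA.
have -> : deg_in (nonadj e) A x = 0; last by lia.
apply/eq_card0 => y; rewrite !inE /nonadj; apply/and3P => -[yA xy].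
by rewrite cA.
Qed.

Lemma pairs_nonadj e W : irreflexive e ->
  pairs e W W + pairs (nonadj e) W W + #|W| = #|W| ^ 2.
Proof.
move=> eirr; rewrite -[X in _ + X = _]sum1_card -!big_split -mulnn -sum_nat_const /=.
by apply: eq_bigr => x xW; rewrite -(deg_in_nonadj W x eirr) xW.
Qed.

Lemma pairs_setU1 e x X : symmetric e -> irreflexive e -> x \notin X ->
  pairs e (x |: X) (x |: X) = 2 * deg_in e X x + pairs e X X.
Proof.
move=> esym eirr xX; rewrite (@pairs_setID e [set x]) ?subsetUl // setU1K //.
by rewrite {1 2}/pairs !big_set1 deg_inE big_set1 eirr.
Qed.

Lemma exists_subset_card A m : m <= #|A| -> exists2 B : {set T}, B \subset A & #|B| = m.
Proof.
rewrite -bin_gt0 -cards_draws => /card_gt0P[B].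
by rewrite inE => /andP[BA /eqP Bm]; exists B.
Qed.

End PairCounts.

Section DenseSets.
Variables (T : finType) (e : rel T).
Hypotheses (esym : symmetric e) (eirr : irreflexive e).
Implicit Types (W H : {set T}).

Definition exchange_stable W :=
  forall a s, a \in W -> s \notin W -> deg_in e (W :\ a) s <= deg_in e (W :\ a) a.

Definition pendant_outside H := forall s, s \notin H -> deg_in e H s <= 1.

Lemma exists_exchange_stable m : m <= #|T| ->
  exists2 W : {set T}, #|W| = m & exchange_stable W.
Proof.
rewrite -cardsT => /exists_subset_card[W0 _ /eqP W0m].
have [W /eqP Wm Wmax] := @arg_maxnP _ W0 (fun X : {set T} => #|X| == m)
  (fun X => pairs e X X) W0m.
exists W => // a s aW sW; have cWa := cardsD1 a W; rewrite aW Wm in cWa.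
have sWa : s \notin W :\ a by rewrite inE (negPf sW) andbF.
have : pairs e (s |: (W :\ a)) (s |: (W :\ a)) <= pairs e W W.
  by apply: Wmax; rewrite /= cardsU1 sWa; lia.
rewrite -{3 4}(setD1K aW) !pairs_setU1 //; last by rewrite setD11.
by rewrite leq_add2r leq_mul2l.
Qed.

Lemma obstruction1_pendant_outside W : exchange_stable W -> posa_obstruction e W 1 ->
  exists2 H : {set T}, #|H| = #|W|.-1 & pendant_outside H.
Proof.
move=> stable [_ _ /card_gt0P[a]]; rewrite inE => /andP[aW].
rewrite (deg_inD1 _ _ aW) eirr => da.
exists (W :\ a); first by rewrite (cardsD1 a W) aW.
move=> s; rewrite !inE negb_and negbK => /orP[/eqP -> //|sW].
exact: leq_trans (stable _ _ aW sW) da.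
Qed.

(* A vertex of degree at most i in an exchange-stable set W forces every outer vertex
   to have at most i + 1 neighbours in W. *)
Lemma obstruction_nonadj_pairs W i : exchange_stable W -> posa_obstruction e W i ->
  2 * ((#|~: W| + i) * (#|W| - i.+1)) <= pairs (nonadj e) setT setT + i * i.-1.
Proof.
move=> stable [i0 _ /exists_subset_card[A /subsetP lowA cA]].
have {}lowA x : x \in A -> x \in W /\ deg_in e W x <= i.
  by move=> /lowA; rewrite inE => /andP.
have nsym := nonadj_sym esym; have nirr := @nonadj_irr _ e.
have AW : A \subset W by apply/subsetP => x /lowA[].
have /card_gt0P[a /lowA[aW da]] : 0 < #|A| by rewrite cA.
have outer : #|~: W| * (#|W| - i.+1) <= pairs (nonadj e) (~: W) W.
  apply: pairs_ge => s; rewrite inE => sW.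
  have := deg_in_nonadj W s eirr; have := stable _ _ aW sW; move: da.
  by rewrite !(deg_inD1 _ _ aW) eirr (negPf sW); case: (e s a); lia.
have low : #|A| * (#|W| - i.+1) <= pairs (nonadj e) A W.
  apply: pairs_ge => x /lowA[xW dx].
  by have := deg_in_nonadj W x eirr; rewrite xW; lia.
have := @pairs_setID _ (nonadj e) (~: W) setT nsym (subsetT _).
have := pairs_setID nsym AW; have := pairs_setIDr (nonadj e) A AW.
have := pairs_self_le A nirr.
by rewrite setTD setCK -cA mulnDl; lia.
Qed.

(* Equality holds at i = 2, and the difference of the two sides is concave in i. *)
Lemma obstruction_count_ge N k i : 1 <= k -> 5 * k + 11 <= N -> 2 <= i -> i.*2 <= N ->
  2 * ((k + 1) * (N - 2)) + i * i.-1 <= 2 * ((k - 1 + i) * (N - i)) + 2.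
Proof.
move=> k1 Nk i2 iN.
have [t iE] : exists t, i = t + 2 by exists (i - 2); lia.
have [K kE] : exists K, k = K.+1 by exists k.-1; lia.
have [D NE] : exists D, N = D + (2 * t + 4) by exists (N - (2 * t + 4)); lia.
rewrite {}iE {}kE {}NE in k1 Nk i2 iN *.
have -> : (t + 2).-1 = t + 1 by lia.
by nia.
Qed.

Theorem pancyclic_or_pendant_outside n k : #|T| = n -> 1 <= k -> 6 * k + 11 <= n ->
    pairs (nonadj e) setT setT + 3 <= 2 * ((k + 1) * (n - k - 2)) ->
  (forall l, 3 <= l <= n - k + 1 -> has_ucycle e l) \/
  exists2 H : {set T}, #|H| = n - k & pendant_outside H.
Proof.
move=> Tn k1 nk few.
have [|W Wn stable] := @exists_exchange_stable (n - k + 1); first by lia.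
have [|span|[i obs]] := posa (W := W) esym eirr; first by lia.
  left=> l; rewrite -Wn; apply: pancyclic => //.
  have total := pairs_nonadj W eirr; rewrite {1}/pairs in total.
  have split := @pairs_setID _ (nonadj e) W setT (nonadj_sym esym) (subsetT _).
  have size_W : 5 * k + 12 <= #|W| by lia.
  rewrite (_ : n - k - 2 = #|W| - 3) in few; last by lia.
  have {split} few_in : pairs (nonadj e) W W + 3 <= 2 * ((k + 1) * (#|W| - 3)) by lia.
  by clear - total few_in size_W; nia.
right; have [_ i2 _] := obs; have [i_le1|i_gt1] := leqP i 1.
  have i1 : i = 1 by case: obs => i0 _ _; lia.
  rewrite i1 in obs; have [H Hn pend] := obstruction1_pendant_outside stable obs.
  by exists H; rewrite // Hn; lia.
have := obstruction_nonadj_pairs stable obs.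
have -> : #|~: W| = k - 1 by have := cardsC W; lia.
have := @obstruction_count_ge (n - k) k i k1.
have -> : #|W| - i.+1 = n - k - i by lia.
by lia.
Qed.

End DenseSets.

Section NeighbourhoodDegrees.
Variables (T : finType) (e : rel T).
Hypotheses (esym : symmetric e) (eirr : irreflexive e).

Lemma neighbourhood_count_le d t s r : 0 < d -> t <= d ^ 2 + s -> t <= d * (d + r) ->
  (d ^ 2 + t) * (d + r) <= d * (d + t + s + (d + r) * (d + r - 1)).
Proof.
rewrite -!mulnn => d0 t_inner t_total.
suff : t * r + d * r <= d * s + d * r * (d + r).
  have [m ->] : exists m, d = m.+1 by exists d.-1; lia.
  by rewrite (_ : m.+1 + r - 1 = m + r); lia.
have [rd|/ltnW dr] := leqP r d.
  have : t * r <= (d * d + s) * r by rewrite leq_mul2r t_inner orbT.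
  have : s * r <= d * s by rewrite mulnC leq_mul2r rd orbT.
  by case: r {t_total rd} => [|r]; nia.
have [j rE] : exists j, r = d + j by exists (r - d); lia.
rewrite {r dr}rE in t_total *.
have : t * d <= (d * d + s) * d by rewrite leq_mul2r t_inner orbT.
have : t * j <= d * (d + (d + j)) * j by rewrite leq_mul2r t_total orbT.
have : d * (d + j) <= d * (d + j) * d by rewrite leq_pmulr.
by clear t_inner t_total; lia.
Qed.

(* In the usual form, d + t / d <= 2 m / (n - 1) + n - 2 for m edges and n vertices,
   where t is the sum of the degrees of the neighbours of u. *)
Lemma neighbourhood_degrees_le u (d := deg_in e setT u) : 0 < d ->
  (d ^ 2 + pairs e [set v | e u v] setT) * (#|T| - 1) <=
  d * (pairs e setT setT + (#|T| - 1) * (#|T| - 2)).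
Proof.
move=> d0; pose N := [set v | e u v]; pose U := u |: N; set t := pairs e N setT.
have uN : u \notin N by rewrite inE eirr.
have dN : d = #|N| by apply: eq_card => v; rewrite !inE.
have dT v : deg_in e setT v <= #|T| - 1.
  by have := deg_in_nonadj setT v eirr; rewrite inE cardsT; lia.
pose s := pairs e (setT :\: U) setT.
have total : pairs e setT setT = d + t + s.
  rewrite (@pairs_setIDr _ _ setT U) ?subsetT // !(pairsC setT) //.
  by rewrite {1}/pairs (big_setU1 _ uN).
have inner : t <= d ^ 2 + s.
  rewrite /t (@pairs_setIDr _ _ N U) ?subsetT // leq_add //.
    rewrite -mulnn {1}dN; apply: pairs_le => v vN.
    have := deg_in_nonadj U v eirr.
    by rewrite cardsU1 uN -dN !inE (_ : e u v) ?orbT; [lia|rewrite inE in vN].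
  by rewrite (pairsC N) //; apply: leq_sum => v _; rewrite deg_in_le ?subsetT.
have t_le : t <= d * (#|T| - 1) by rewrite /t dN; apply: pairs_le => v _; apply: dT.
have [r rE] : exists r, #|T| - 1 = d + r by exists (#|T| - 1 - d); have := dT u; lia.
have -> : #|T| - 2 = d + r - 1 by lia.
rewrite rE in t_le *; rewrite total; exact: neighbourhood_count_le.
Qed.

End NeighbourhoodDegrees.

(* E and M stand for the numbers of ordered adjacent and nonadjacent pairs. *)
Lemma nonadj_le_of_square_bound n k E M : E + M + n = n ^ 2 -> 1 <= k -> k + 2 <= n ->
    (n - k - 1) ^ 2 * n <= E * (n - 1) -> (k + 3) * (k + 4) <= 2 * n ->
  M + 3 <= 2 * ((k + 1) * (n - k - 2)).
Proof.
move=> total k1 kn edges nk2.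
have [j nE] : exists j, n = j + k + 2 by exists (n - k - 2); lia.
have n_k1 : n - k - 1 = j + 1 by lia.
have n_1 : n - 1 = j + k + 1 by lia.
rewrite (_ : n - k - 2 = j); last by lia.
rewrite {}n_k1 {}n_1 {kn}nE in total edges nk2.
have M_lt : M + k ^ 2 < 2 * k * (j + k + 2).
  rewrite -(@ltn_pmul2r (j + k + 1)); last by lia.
  have := congr1 (muln^~ (j + k + 1)) total.
  have : 0 < k * k by rewrite muln_gt0 k1.
  by clear total nk2; lia.
by clear total edges; lia.
Qed.

Lemma nonadj_le_of_linear_bound n k E M : E + M + n = n ^ 2 -> k + 2 <= n ->
    2 * (n - k - 1) * (n - 1) < E + (n - 1) * (n - 2) -> k ^ 2 + 2 * k + 3 <= n ->
  M + 3 <= 2 * ((k + 1) * (n - k - 2)).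
Proof.
move=> total kn edges nk2.
have [j nE] : exists j, n = j + k + 2 by exists (n - k - 2); lia.
have n_k1 : n - k - 1 = j + 1 by lia.
have n_1 : n - 1 = j + k + 1 by lia.
have n_2 : n - 2 = j + k by lia.
rewrite (_ : n - k - 2 = j); last by lia.
rewrite {}n_k1 {}n_1 {}n_2 {kn}nE in total edges nk2.
have M_lt : M < 2 * k * (j + k + 1) by clear nk2; lia.
by clear total edges; lia.
Qed.

(** * Rayleigh quotients *)

Local Open Scope ring_scope.

Lemma CauchySchwarz_sum (R : realDomainType) (I : finType) (a b : I -> R) :
  (\sum_i a i * b i) ^+ 2 <= (\sum_i a i ^+ 2) * (\sum_i b i ^+ 2).
Proof.
set C := \sum_i a i * b i; set A := \sum_i a i ^+ 2; set B := \sum_i b i ^+ 2.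
have AB : A * B = \sum_i \sum_j a j ^+ 2 * b i ^+ 2.
  by rewrite /A /B big_distrlr exchange_big.
have lagrange : \sum_i \sum_j (a i * b j - a j * b i) ^+ 2 = 2 * (A * B - C ^+ 2).
  have -> : 2 * (A * B - C ^+ 2) = A * B + A * B - 2 * C ^+ 2 by ring.
  rewrite {2}AB /A /B /C expr2 !big_distrlr /= mulr_sumr -big_split -sumrB.
  apply: eq_bigr => i _ /=; rewrite mulr_sumr -big_split -sumrB.
  by apply: eq_bigr => j _ /=; ring.
have : 0 <= 2 * (A * B - C ^+ 2).
  by rewrite -lagrange; apply: sumr_ge0 => i _; apply: sumr_ge0 => j _; apply: sqr_ge0.
by rewrite pmulr_rge0 // subr_ge0.
Qed.

Lemma quadratic_ge0_linear_eq0 (R : realFieldType) (b c : R) : 0 <= c ->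
  (forall t, 0 <= 2 * t * b + t ^+ 2 * c) -> b = 0.
Proof.
move=> c0 /(_ (- b / (c + 1))); have c1 : 0 < c + 1 by rewrite ltr_wpDl.
have -> : 2 * (- b / (c + 1)) * b + (- b / (c + 1)) ^+ 2 * c =
    - (b ^+ 2 * (c + 2) / (c + 1) ^+ 2) by field; rewrite gt_eqF.
rewrite oppr_ge0 pmulr_lle0 ?invr_gt0 ?exprn_gt0 // pmulr_lle0; last by lra.
by rewrite exprn_even_le0 // => /eqP.
Qed.

Lemma eigenvalue_conj_diag (F : fieldType) m (P N : 'M[F]_m) (d : 'rV_m) i :
  P \in unitmx -> N = invmx P *m diag_mx d *m P -> eigenvalue N (d 0 i).
Proof.
move=> Pu NE; apply/eigenvalueP; exists (row i P).
  rewrite NE !mulmxA -row_mul mulmxV // -row_mul mul1mx.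
  by rewrite row_diag_mx -scalemxAl -rowE.
apply: contraTneq Pu => Pi0; rewrite -row_free_unit; apply/row_freePn.
by exists i; rewrite Pi0 sub0mx.
Qed.

Section Rayleigh.
Variable R : realType.
Implicit Types (m : nat).

Section Complexification.
Import complex.
Local Open Scope sesquilinear_scope.

Lemma complexified_sym_hermsym m (M : 'M[R]_m) : M^T = M ->
  map_mx (real_complex R) M \is hermsymmx.
Proof.
move=> Msym; apply: realsym_hermsym.
  apply/is_hermitianmxP; rewrite expr0 scale1r map_mx_id //.
  by apply/matrixP => i j; rewrite !mxE -{1}Msym mxE.
by apply/mxOverP => i j; rewrite mxE; apply/complex_realP; exists (M i j).
Qed.

Lemma spectral_diag_le m (M : 'M[R]_m) (N := map_mx (real_complex R) M) i :
  M^T = M -> spectral_diag N 0 i <= real_complex R (max_eigenvalue M).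
Proof.
move=> Msym; have Nh := complexified_sym_hermsym Msym.
have dR : spectral_diag N 0 i \is Num.real.
  by have /mxOverP := hermitian_spectral_diag_real Nh; apply.
have m0 : (0 < m)%N by apply: leq_ltn_trans (ltn_ord i).
have [_ lmax] := max_eigenvalueP m0 Msym.
rewrite -(RRe_real dR) lecR; apply: lmax.
rewrite -(eigenvalue_map (real_complex R)) /= RRe_real //.
apply: eigenvalue_conj_diag (spectral_unit _) _.
exact/orthomx_spectralP/hermitian_normalmx.
Qed.

(* In a unitary basis of eigenvectors of M with coordinates y, both sides are sums
   weighted by the squared moduli of y. *)
Theorem rayleigh_le m (M : 'M[R]_m) (v : 'rV[R]_m) : M^T = M ->
  (v *m M *m v^T) 0 0 <= max_eigenvalue M * (v *m v^T) 0 0.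
Proof.
move=> Msym; pose f := real_complex R; pose N := map_mx f M; pose w := map_mx f v.
have Nh : N \is hermsymmx by apply: complexified_sym_hermsym.
have /orthomx_spectralP := hermitian_normalmx Nh; have := spectral_unitarymx N.
set P := spectralmx N; set d := spectral_diag N => PU defN.
pose y := w *m invmx P.
have wR : w^T = w ^t* by apply/matrixP => i j; rewrite !mxE; apply/esym/conjc_real.
have yE : y ^t* = P *m w^T.
  rewrite /y invmx_unitary // trmx_mul map_mxM -wR; congr (_ *m _).
  by apply/matrixP => i j; rewrite !mxE; apply: conjcK.
have formE : f ((v *m M *m v^T) 0 0) = (y *m diag_mx d *m y ^t*) 0 0.
  have <- : w *m N *m w^T = y *m diag_mx d *m y ^t* by rewrite yE {1}defN !mulmxA.
  by rewrite map_trmx -!map_mxM [RHS]mxE.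
have normE : f ((v *m v^T) 0 0) = (y *m y ^t*) 0 0.
  by rewrite yE /y mulmxA mulmxKV ?spectral_unit // /w map_trmx -map_mxM [RHS]mxE.
have fM : {morph f : a b / a * b} by apply: rmorphM.
rewrite -lecR -!/(f _) fM formE normE; move: y {yE formE normE} => y.
rewrite mul_mx_diag !mxE mulr_sumr; apply: ler_sum => i _.
rewrite !mxE [y 0 i * d 0 i]mulrC -mulrA.
by apply: ler_wpM2r (spectral_diag_le i Msym); rewrite -normCK exprn_ge0.
Qed.

End Complexification.

(* Perturb x in the direction x S. *)
Lemma psd_kernel m (S : 'M[R]_m) (x : 'rV[R]_m) : S^T = S ->
  (forall v : 'rV_m, 0 <= (v *m S *m v^T) 0 0) -> (x *m S *m x^T) 0 0 = 0 ->
  x *m S = 0.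
Proof.
move=> Ssym psd x0; set z := x *m S.
have zE : (z *m z^T) 0 0 = \sum_i z 0 i ^+ 2.
  by rewrite mxE; apply: eq_bigr => i _; rewrite [z^T _ _]mxE expr2.
suff : (z *m z^T) 0 0 = 0.
  rewrite zE => /psumr_eq0P z0; apply/rowP => i; rewrite [RHS]mxE; apply/eqP.
  by rewrite -sqrf_eq0; apply/eqP/z0 => // j _; exact: sqr_ge0.
apply: quadratic_ge0_linear_eq0 (psd z) _ => t.
have zS : z *m S *m x^T = z *m z^T by rewrite -mulmxA -{1}Ssym -trmx_mul.
have := psd (x + t *: z).
rewrite linearD /= linearZ /= !(mulmxDl, mulmxDr) -!scalemxAl -!scalemxAr zS -/z.
rewrite ![fun_of_matrix (_ + _) _ _]mxE ![fun_of_matrix (_ *: _) _ _]mxE x0 add0r.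
by congr (0 <= _); ring.
Qed.

Theorem rayleigh_eq m (M : 'M[R]_m) (v : 'rV[R]_m) : M^T = M ->
  (v *m M *m v^T) 0 0 = max_eigenvalue M * (v *m v^T) 0 0 ->
  v *m M = max_eigenvalue M *: v.
Proof.
move=> Msym vE; set l := max_eigenvalue M in vE *.
have formE w : (w *m (l%:M - M) *m w^T) 0 0 = l * (w *m w^T) 0 0 - (w *m M *m w^T) 0 0.
  by rewrite mulmxBr mulmxBl mul_mx_scalar -scalemxAl !mxE.
have : v *m (l%:M - M) = 0.
  apply: psd_kernel; last by rewrite formE vE subrr.
    by rewrite linearB /= tr_scalar_mx Msym.
  by move=> w; rewrite formE subr_ge0 rayleigh_le.
by rewrite mulmxBr mul_mx_scalar => /eqP; rewrite subr_eq0 => /eqP ->.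
Qed.

End Rayleigh.

(** * The matrices A + b D *)

Section AdjacencyDegreeOperator.
Variables (R : comNzRingType) (T : finType).
Implicit Types (r : rel T) (b : R) (x : T -> R) (H : {set T}).

Definition adjdeg_op r b x (u : T) := \sum_v (r u v)%:R * (x v + b * x u).

Definition adjdeg_form r b x := \sum_u x u * adjdeg_op r b x u.

Lemma natr_pairs r X Y :
  (pairs r X Y)%:R = \sum_(u in X) \sum_(v in Y) (r u v)%:R :> R.
Proof. by rewrite natr_sum; apply: eq_bigr => u _; rewrite deg_inE natr_sum. Qed.

Lemma sum_indicator H (F : T -> R) : \sum_u (u \in H)%:R * F u = \sum_(u in H) F u.
Proof.
by rewrite [RHS]big_mkcond; apply: eq_bigr => u _; rewrite mulr_natl mulrb.
Qed.

Lemma adjdeg_form_indicator r b H : adjdeg_form r b (fun u => (u \in H)%:R) =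
  (pairs r H H)%:R + b * (pairs r H setT)%:R.
Proof.
rewrite !natr_pairs mulr_sumr -big_split /adjdeg_form sum_indicator.
apply: eq_bigr => u uH; rewrite /adjdeg_op uH mulr1 mulr_sumr /=.
under eq_bigr do rewrite mulrDr.
rewrite big_split /=; congr (_ + _).
  by rewrite -sum_indicator; apply: eq_bigr => v _; rewrite mulrC.
by apply: eq_big => [v|v _]; rewrite ?inE // mulrC.
Qed.

End AdjacencyDegreeOperator.

Lemma adjdeg_op_comp (R : comNzRingType) (T T' : finType) (r : rel T) (r' : rel T') (b : R)
    (x : T' -> R) (h : T -> T') : bijective h -> {mono h : u v / r u v >-> r' u v} ->
  adjdeg_op r b (x \o h) =1 adjdeg_op r' b x \o h.
Proof.
move=> h_bij hr u; rewrite /adjdeg_op /= [RHS](reindex h) /=; last exact: onW_bij.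
by apply: eq_bigr => v _; rewrite hr.
Qed.

Section AdjacencyDegreeRadius.
Variable R : realType.
Implicit Types (b : R) (G : sgraph).

Definition adjdeg_mx b G := adjacency_mx R G + b *: degree_mx R G.

Definition adjdeg_radius b G := max_eigenvalue (adjdeg_mx b G).

Lemma spectral_radiusE G : spectral_radius R G = adjdeg_radius 0 G.
Proof. by rewrite /adjdeg_radius /adjdeg_mx scale0r addr0. Qed.

Lemma signless_spectral_radiusE G : signless_spectral_radius R G = adjdeg_radius 1 G.
Proof. by rewrite /adjdeg_radius /adjdeg_mx scale1r. Qed.

Lemma adjdeg_mx_sym b G : (adjdeg_mx b G)^T = adjdeg_mx b G.
Proof.
by rewrite /adjdeg_mx linearD /= linearZ /= adjacency_mx_sym /degree_mx tr_diag_mx.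
Qed.

Lemma mul_adjdeg_mx b G (x : G -> R) (u : G) :
  ((\row_i x (enum_val i)) *m adjdeg_mx b G) 0 (enum_rank u) = adjdeg_op (@adj G) b x u.
Proof.
have degE : (degree u)%:R = \sum_v (adj u v)%:R :> R.
  have -> : degree u = deg_in (@adj G) setT u by apply: eq_card => v; rewrite !inE.
  by rewrite deg_inE natr_sum; apply: eq_bigl => v; rewrite inE.
rewrite mulmxDr -scalemxAr mul_mx_diag !mxE enum_rankK degE /adjdeg_op.
under [RHS]eq_bigr do rewrite mulrDr.
rewrite big_split -mulr_suml /=; congr (_ + _); last by ring.
rewrite [RHS]big_enum_val; apply: eq_bigr => i _.
by rewrite !mxE enum_rankK adj_sym mulrC.
Qed.

Lemma adjdeg_mx_form b G (x : G -> R) (v := \row_i x (enum_val i)) :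
  (v *m adjdeg_mx b G *m v^T) 0 0 = adjdeg_form (@adj G) b x.
Proof.
rewrite mxE /adjdeg_form [RHS]big_enum_val; apply: eq_bigr => i _.
by rewrite -mul_adjdeg_mx enum_valK mulrC !mxE.
Qed.

Lemma row_fun_norm (T : finType) (x : T -> R) (v := \row_(i < #|T|) x (enum_val i)) :
  (v *m v^T) 0 0 = \sum_u x u ^+ 2.
Proof. by rewrite mxE [RHS]big_enum_val; apply: eq_bigr => i _; rewrite !mxE. Qed.

Lemma adjdeg_form_le b G (x : G -> R) :
  adjdeg_form (@adj G) b x <= adjdeg_radius b G * \sum_u x u ^+ 2.
Proof. by rewrite -adjdeg_mx_form -row_fun_norm rayleigh_le // adjdeg_mx_sym. Qed.

Lemma adjdeg_form_eq b G (x : G -> R) :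
  adjdeg_form (@adj G) b x = adjdeg_radius b G * \sum_u x u ^+ 2 ->
  adjdeg_op (@adj G) b x =1 fun u => adjdeg_radius b G * x u.
Proof.
rewrite -adjdeg_mx_form -row_fun_norm => /rayleigh_eq xE u.
by rewrite -mul_adjdeg_mx xE ?adjdeg_mx_sym // !mxE enum_rankK.
Qed.

Definition adjdeg_eigenfun b G l (x : G -> R) :=
  (exists u, x u != 0) /\ adjdeg_op (@adj G) b x =1 fun u => l * x u.

Lemma eigenvalue_adjdegP b G l :
  eigenvalue (adjdeg_mx b G) l <-> exists x, @adjdeg_eigenfun b G l x.
Proof.
split=> [/eigenvalueP[v vE /rV0Pn[i vi]]|[x [[u xu] xE]]].
  exists (fun u => v 0 (enum_rank u)); split.
    by exists (enum_val i); rewrite enum_valK.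
  move=> u; rewrite -mul_adjdeg_mx; have -> : \row_j v 0 (enum_rank (enum_val j)) = v.
    by apply/rowP => j; rewrite mxE enum_valK.
  by rewrite vE mxE.
apply/eigenvalueP; exists (\row_i x (enum_val i)).
  by apply/rowP => i; rewrite -[i in LHS]enum_valK mul_adjdeg_mx xE !mxE.
by apply/rV0Pn; exists (enum_rank u); rewrite mxE enum_rankK.
Qed.

Lemma adjdeg_radius_iso b G G' : sgraph_iso G G' -> adjdeg_radius b G = adjdeg_radius b G'.
Proof.
move=> [f [g fK gK] fadj]; congr sup; apply/funext => l; apply/propext => /=.
have f_bij : bijective f by exists g.
have g_bij : bijective g by exists f.
have gadj : {mono g : u v / adj u v} by move=> u v; rewrite -fadj !gK.
rewrite !eigenvalue_adjdegP; split=> -[x [[u xu] xE]].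
  exists (x \o g); split; first by exists (f u); rewrite /= fK.
  by move=> v; rewrite (adjdeg_op_comp _ _ g_bij gadj) /= xE.
exists (x \o f); split; first by exists (g u); rewrite /= gK.
by move=> v; rewrite (adjdeg_op_comp _ _ f_bij fadj) /= xE.
Qed.

(* Replacing an eigenvector by its absolute value does not decrease the form. *)
Lemma exists_nonneg_eigenfun b G : (0 < #|G|)%N ->
  exists2 x, adjdeg_eigenfun b (adjdeg_radius b G) x & forall u : G, 0 <= x u.
Proof.
move=> G0; have [/eigenvalue_adjdegP[x [[u xu] xE]] _] :=
  max_eigenvalueP G0 (adjdeg_mx_sym b G).
exists (fun u => `|x u|) => [|v]; last exact: normr_ge0.
split; first by exists u; rewrite normr_eq0.
apply: adjdeg_form_eq; apply: le_anti; rewrite adjdeg_form_le /= mulr_sumr.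
apply: ler_sum => v _; rewrite real_normK ?num_real // expr2 mulrCA -xE !mulr_sumr.
apply: ler_sum => w _; rewrite mulrCA [leRHS]mulrCA ler_wpM2l // !mulrDr lerD //.
  by rewrite -normrM ler_norm.
by rewrite mulrCA [leRHS]mulrCA -!expr2 real_normK ?num_real.
Qed.

Lemma adjdeg_radius_indicator_ge b G (H : {set G}) :
  (pairs (@adj G) H H)%:R + b * (pairs (@adj G) H setT)%:R <= adjdeg_radius b G * #|H|%:R.
Proof.
rewrite -adjdeg_form_indicator; apply: le_trans (adjdeg_form_le _ _) _.
have -> // : \sum_u (u \in H)%:R ^+ 2 = #|H|%:R :> R.
rewrite -sum1_card natr_sum -sum_indicator; apply: eq_bigr => u _.
by case: (u \in H); rewrite ?expr1n ?expr0n ?mulr1.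
Qed.

Lemma clique_spectral_radius_ge G (H : {set G}) : clique (@adj G) H -> (0 < #|H|)%N ->
  #|H|.-1%:R <= spectral_radius R G.
Proof.
move=> cH H0; have := adjdeg_radius_indicator_ge 0 H.
rewrite pairs_clique ?mul0r ?addr0 -?spectral_radiusE //; last exact: adj_irr.
by rewrite mulnC natrM ler_pM2r // ltr0n.
Qed.

Lemma clique_signless_radius_gt G (H : {set G}) u v : clique (@adj G) H ->
    u \in H -> v \notin H -> adj u v ->
  (2 * #|H|.-1)%:R < signless_spectral_radius R G.
Proof.
move=> cH uH vH uv; have := adjdeg_radius_indicator_ge 1 H.
have H0 : 0 < #|H|%:R :> R by rewrite ltr0n; apply/card_gt0P; exists u.
have leaving : (0 < pairs (@adj G) H (~: H))%N.
  rewrite /pairs (big_setD1 u) //= addn_gt0; apply/orP; left.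
  by apply/card_gt0P; exists v; rewrite !inE vH.
rewrite (pairs_setIDr _ _ (subsetT H)) setTD pairs_clique; last by []; last exact: adj_irr.
rewrite mul1r -natrD -(ltr_pM2r H0) -signless_spectral_radiusE.
by apply: lt_le_trans; rewrite -natrM ltr_nat; lia.
Qed.

End AdjacencyDegreeRadius.

(** * Spectral bounds on the number of edges *)

Section SpectralUpperBounds.
Variable R : realType.

Lemma adjacency_form_sqr_le (T : finType) (r : rel T) (x : T -> R) : irreflexive r ->
  adjdeg_form r 0 x ^+ 2 <=
  (pairs r setT setT)%:R * ((\sum_u x u ^+ 2) ^+ 2 - \sum_u (x u ^+ 2) ^+ 2).
Proof.
move=> rirr.
have pairsE : (pairs r setT setT)%:R = \sum_(p : T * T) (r p.1 p.2)%:R ^+ 2 :> R.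
  rewrite natr_pairs pair_big /=; apply: eq_big => [p|p _]; rewrite ?inE //.
  by case: (r _ _); rewrite ?expr1n ?expr0n.
have -> : (\sum_u x u ^+ 2) ^+ 2 - \sum_u (x u ^+ 2) ^+ 2 =
    \sum_(p : T * T) ((p.1 != p.2)%:R * (x p.1 * x p.2)) ^+ 2.
  rewrite -(pair_bigA _ (fun u v => ((u != v)%:R * (x u * x v)) ^+ 2)) /=.
  rewrite expr2 mulr_suml -sumrB; apply: eq_bigr => u _.
  rewrite mulr_sumr (bigD1 u) //= [RHS](bigD1 u) //= eqxx mul0r expr0n add0r.
  rewrite addrAC -expr2 subrr add0r; apply: eq_bigr => v vu.
  by rewrite eq_sym vu mul1r exprMn.
have -> : adjdeg_form r 0 x =
    \sum_(p : T * T) (r p.1 p.2)%:R * ((p.1 != p.2)%:R * (x p.1 * x p.2)).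
  rewrite -(pair_bigA _ (fun u v => (r u v)%:R * ((u != v)%:R * (x u * x v)))) /=.
  apply: eq_bigr => u _; rewrite mulr_sumr; apply: eq_bigr => v _.
  have [<-|_] := eqVneq u v; first by rewrite rirr mulr0n; ring.
  by rewrite mulr1n; ring.
by rewrite pairsE; apply: CauchySchwarz_sum.
Qed.

Variable G : sgraph.
Implicit Type x : G -> R.
Let e := @adj G.

Theorem spectral_radius_sqr_le : (0 < #|G|)%N ->
  spectral_radius R G ^+ 2 * #|G|%:R <= (pairs e setT setT)%:R * (#|G| - 1)%:R.
Proof.
move=> G0; have [x [[u xu] xE] _] := exists_nonneg_eigenfun (0 : R) G0.
rewrite spectral_radiusE; set l := adjdeg_radius 0 G in xE *.
have := adjacency_form_sqr_le x (@adj_irr G); rewrite -/e.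
have -> : adjdeg_form e 0 x = l * \sum_u x u ^+ 2.
  by rewrite mulr_sumr; apply: eq_bigr => v _; rewrite xE; ring.
set N := \sum_u x u ^+ 2; set X4 := \sum_u _ => edges.
have N0 : 0 < N.
  rewrite /N (bigD1 u) //= ltr_wpDr ?exprn_even_gt0 //.
  by apply: sumr_ge0 => v _; apply: sqr_ge0.
have mean : N ^+ 2 <= #|G|%:R * X4.
  have := CauchySchwarz_sum (fun=> 1) (fun u => x u ^+ 2).
  by rewrite expr1n sumr_const; under eq_bigr do rewrite mul1r.
rewrite -(ler_pM2r (exprn_gt0 2 N0)) natrB //.
have := ler_wpM2r (ler0n R #|G|) edges.
have := ler_wpM2l (ler0n R (pairs e setT setT)) mean.
by rewrite exprMn; lra.
Qed.

(* The vertex is one that maximises |x u| / degree u. *)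
Lemma exists_signless_eigen_vertex x l : 0 < l -> adjdeg_eigenfun 1 l x ->
  exists2 u, (0 < deg_in e setT u)%N &
    l * (deg_in e setT u)%:R <=
    (deg_in e setT u ^ 2 + pairs e [set v | e u v] setT)%:R.
Proof.
move=> l0 [[u1 xu1] xE]; pose d u : R := (deg_in e setT u)%:R.
have dE u : d u = \sum_v (e u v)%:R.
  by rewrite /d deg_inE natr_sum; apply: eq_bigl => v; rewrite inE.
have isolated u : d u = 0 -> x u = 0.
  rewrite dE => /psumr_eq0P du; have /eqP := xE u; rewrite /adjdeg_op big1.
    by rewrite eq_sym mulf_eq0 gt_eqF //= => /eqP.
  by move=> v _; rewrite du ?mul0r.
have [u _ umax] := Order.TotalTheory.arg_maxP (P := predT) (i0 := u1)
  (fun u => `|x u| / d u) isT.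
set y := `|x u| / d u in umax.
have le_y v : `|x v| <= y * d v.
  have [dv|dv] := eqVneq (d v) 0; first by rewrite isolated // normr0 dv mulr0.
  by rewrite -ler_pdivrMr; [apply: umax|rewrite lt_def dv ler0n].
have y0 : 0 < y.
  have : 0 < y * d u1 by apply: lt_le_trans (le_y u1); rewrite normr_gt0.
  by apply: contraTT; rewrite -!leNgt => y0; rewrite mulr_le0_ge0 ?ler0n.
have du0 : 0 < d u.
  rewrite lt_def ler0n andbT; apply: contraTneq y0; rewrite /y => ->.
  by rewrite invr0 mulr0 ltxx.
have xuE : `|x u| = y * d u by rewrite /y divfK ?gt_eqF.
exists u; first by rewrite -(ltr0n R).
rewrite natrD natrX -/(d u) natr_sum -(ler_pM2l y0) mulrCA -xuE.
rewrite -{1}(gtr0_norm l0) -normrM -xE; apply: le_trans (ler_norm_sum _ _ _) _.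
rewrite mulrDr expr2 mulrA -xuE dE mulr_sumr mulr_sumr [X in _ <= _ + X]big_mkcond.
rewrite -big_split; apply: ler_sum => v _ /=; rewrite -/e inE normrM normr_nat mul1r.
case: (e u v); last by rewrite mul0r mulr0 addr0.
rewrite !mul1r mulr1; apply: le_trans (ler_normD _ _) _.
by rewrite [leRHS]addrC lerD2r le_y.
Qed.

Theorem signless_spectral_radius_le : (0 < #|G|)%N ->
  signless_spectral_radius R G * (#|G| - 1)%:R <=
  (pairs e setT setT + (#|G| - 1) * (#|G| - 2))%:R.
Proof.
move=> G0; rewrite signless_spectral_radiusE; set q := adjdeg_radius 1 G.
have [q0|q0] := leP q 0; first by apply: le_trans (ler0n _ _); rewrite mulr_le0_ge0.
have [x xE _] := exists_nonneg_eigenfun (1 : R) G0.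
have [u du qu] := exists_signless_eigen_vertex q0 xE.
have dR : 0 < (deg_in e setT u)%:R :> R by rewrite ltr0n.
rewrite -(ler_pM2l dR) -natrM mulrA [_ * q]mulrC.
apply: le_trans (ler_wpM2r (ler0n _ _) qu) _.
by rewrite -natrM ler_nat neighbourhood_degrees_le //; [apply: adj_sym|apply: adj_irr].
Qed.

End SpectralUpperBounds.

(** * The extremal graph *)

Section HubGraph.
Implicit Types (T : finType).

Definition hub_adj T (a : T) (H : {set T}) : rel T :=
  fun u v => (u != v) && [|| u == a, v == a | (u \in H) == (v \in H)].

Lemma hub_adj_sym T (a : T) H : symmetric (hub_adj a H).
Proof.
move=> u v; rewrite /hub_adj eq_sym [(u \in H) == _]eq_sym.
by congr (_ && _); rewrite orbCA.
Qed.

Lemma hub_adj_irr T (a : T) H : irreflexive (hub_adj a H).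
Proof. by move=> u; rewrite /hub_adj eqxx. Qed.

Definition hub_graph T (a : T) H := SGraph (hub_adj_sym a H) (hub_adj_irr a H).

Lemma fibre_injection T T' (C : eqType) (c : T -> C) (c' : T' -> C) (v0 : T') :
    (forall i, #|[set u | c u == i]| <= #|[set v | c' v == i]|)%N ->
  exists2 f : T -> T', injective f & forall u, c' (f u) = c u.
Proof.
move=> le_fib; pose fib i := enum [set u | c u == i].
pose fib' i := enum [set v | c' v == i].
have mem_fib u : u \in fib (c u) by rewrite mem_enum inE.
have index_lt u : (index u (fib (c u)) < size (fib' (c u)))%N.
  by rewrite -cardE; apply: leq_trans (le_fib _); rewrite cardE index_mem.
pose f u := nth v0 (fib' (c u)) (index u (fib (c u))).
have fc u : c' (f u) = c u.
  by have := mem_nth v0 (index_lt u); rewrite mem_enum inE => /eqP.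
exists f => // u v fuv; have cuv : c u = c v by rewrite -!fc fuv.
have := index_lt u; have := index_lt v; move: (mem_fib u) (mem_fib v) fuv.
rewrite /f cuv => uc vc /eqP + lv lu; rewrite nth_uniq ?enum_uniq // => /eqP uv.
by rewrite -(nth_index u uc) uv nth_index.
Qed.

Lemma card_hub_fibre T (a : T) (H : {set T}) i : a \in H ->
  #|[set u | (u == a, u \in H) == i]| =
  if i.1 then nat_of_bool i.2 else if i.2 then #|H|.-1 else (#|T| - #|H|)%N.
Proof.
move=> aH; case: i => [[] []] /=.
- apply/eqP/cards1P; exists a; apply/setP => u.
  by rewrite !inE xpair_eqE; case: (u =P a) => [->|_]; rewrite ?aH.
- apply/eqP; rewrite cards_eq0; apply/eqP/setP => u.
  by rewrite !inE xpair_eqE; case: (u =P a) => [->|_]; rewrite ?aH.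
- rewrite (cardsD1 a H) aH; apply: eq_card => u.
  by rewrite !inE xpair_eqE eqbF_neg eqb_id.
rewrite -cardsT -cardsDS ?subsetT // setTD; apply: eq_card => u.
by rewrite !inE xpair_eqE !eqbF_neg; case: (u =P a) => [->|_]; rewrite ?aH.
Qed.

Lemma hub_iso (G G' : sgraph) (a : G) (a' : G') (H : {set G}) (H' : {set G'}) :
    @adj G =2 hub_adj a H -> @adj G' =2 hub_adj a' H' -> a \in H -> a' \in H' ->
    #|G| = #|G'| -> #|H| = #|H'| ->
  sgraph_iso G G'.
Proof.
move=> adjG adjG' aH aH' GG' HH'.
have [i|f finj fc] := @fibre_injection G G' _ (fun u => (u == a, u \in H))
  (fun v => (v == a', v \in H')) a'.
  by rewrite !card_hub_fibre // GG' HH'.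
exists f; first by apply: inj_card_bij; rewrite ?GG'.
move=> u v; rewrite adjG adjG' /hub_adj (inj_eq finj).
by have [[-> ->] [-> ->]] := (fc u, fc v).
Qed.

Lemma Lgraph_hub n k : (k < n)%N ->
  exists a, exists2 H : {set Lgraph n k}, a \in H /\ #|H| = (n - k)%N &
    @adj (Lgraph n k) =2 hub_adj a H.
Proof.
move=> kn; pose outer (i : 'I_k) : Lgraph n k := inr (inr i).
pose H : {set Lgraph n k} := ~: [set outer i | i in 'I_k].
have outer_inj : injective outer by move=> i j [].
have memH u : (u \in H) = (if u is inr (inr _) then false else true).
  rewrite inE; case: u => [i|[i|i]]; last by rewrite imset_f.
    by apply/imsetP => -[].
  by apply/imsetP => -[].
exists (inl ord0), H; first split.
- by rewrite memH.
- by have := cardsC H; rewrite setCK card_imset // card_ord card_Lgraph //; lia.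
move=> u v; rewrite /hub_adj !memH.
by case: u v => [i|[i|i]] [j|[j|j]] //=; rewrite ?(ord1 i) ?(ord1 j) ?eqxx ?andbT.
Qed.

Lemma hub_adj_same_side T (a : T) (H : {set T}) u v :
  u != v -> (u \in H) = (v \in H) -> hub_adj a H u v.
Proof. by move=> uv uvH; rewrite /hub_adj uv uvH eqxx !orbT. Qed.

End HubGraph.

Section LgraphRadii.
Variables (R : realType) (n k : nat).
Hypothesis kn : (k < n)%N.

Lemma Lgraph_clique : exists a, exists2 H : {set Lgraph n k},
  clique (@adj _) H /\ #|H| = (n - k)%N & a \in H /\ forall v, v != a -> adj a v.
Proof.
have [a [H [aH cH] hub]] := Lgraph_hub kn; exists a, H; split=> //.
  by move=> u v uH vH uv; rewrite hub hub_adj_same_side ?uH ?vH.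
by move=> v va; rewrite hub /hub_adj eq_sym va eqxx.
Qed.

Lemma spectral_radius_Lgraph_ge : (n - k - 1)%:R <= spectral_radius R (Lgraph n k).
Proof.
have [a [H [cliqueH cH] _]] := Lgraph_clique.
have := clique_spectral_radius_ge R cliqueH; rewrite cH subn1.
by apply; lia.
Qed.

Lemma signless_spectral_radius_Lgraph_gt : (0 < k)%N ->
  (2 * (n - k - 1))%:R < signless_spectral_radius R (Lgraph n k).
Proof.
move=> k0; have [a [H [cliqueH cH] [aH adja]]] := Lgraph_clique.
have /card_gt0P[v] : (0 < #|~: H|)%N.
  by have := cardsC H; rewrite card_Lgraph // cH; lia.
rewrite inE => vH; have va : v != a by apply: contraNneq vH => ->.
by have := clique_signless_radius_gt R cliqueH aH vH (adja v va); rewrite cH subn1.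
Qed.

End LgraphRadii.

Section FewNonadjacentPairs.
Variables (R : realType) (k : nat) (G : sgraph).
Hypotheses (k_ge1 : (1 <= k)%N) (order_ge : (k + 2 <= #|G|)%N).
Local Notation nonadjacent := (pairs (nonadj (@adj G)) setT setT).

Let total : (pairs (@adj G) setT setT + nonadjacent + #|G| = #|G| ^ 2)%N.
Proof. by have := pairs_nonadj setT (@adj_irr G); rewrite cardsT. Qed.

Lemma spectral_radius_few_nonadj :
    spectral_radius R (Lgraph #|G| k) <= spectral_radius R G ->
    ((k + 3) * (k + 4) %/ 2 <= #|G|)%N ->
  (nonadjacent + 3 <= 2 * ((k + 1) * (#|G| - k - 2)))%N.
Proof.
move=> LG order_k.
have lb : (#|G| - k - 1)%:R <= spectral_radius R G.
  by apply: le_trans LG; apply: spectral_radius_Lgraph_ge; lia.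
apply: nonadj_le_of_square_bound total _ _ _ _ => //; last first.
  have : (2 %| (k + 3) * (k + 4))%N by rewrite dvdn2 oddM !oddD; case: (odd k).
  by move/divnK <-; rewrite mulnC leq_mul2l.
rewrite -(ler_nat R) natrM natrX [leRHS]natrM.
apply: le_trans (spectral_radius_sqr_le R _); last by lia.
by rewrite ler_wpM2r // ler_sqr ?nnegrE // (le_trans _ lb).
Qed.

Lemma signless_spectral_radius_few_nonadj :
    signless_spectral_radius R (Lgraph #|G| k) <= signless_spectral_radius R G ->
    (k ^ 2 + 2 * k + 3 <= #|G|)%N ->
  (nonadjacent + 3 <= 2 * ((k + 1) * (#|G| - k - 2)))%N.
Proof.
move=> LG order_k; apply: nonadj_le_of_linear_bound total _ _ order_k => //.
rewrite -(ltr_nat R) natrM.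
apply: lt_le_trans (signless_spectral_radius_le R _); last by lia.
rewrite ltr_pM2r; last by rewrite ltr0n; lia.
by apply: lt_le_trans LG; apply: signless_spectral_radius_Lgraph_gt; lia.
Qed.

End FewNonadjacentPairs.

(** * Comparison with the extremal graph *)

Section EdgeWeights.
Variables (R : realDomainType) (T : finType) (w : T -> T -> R).
Hypotheses (w_sym : forall u v, w u v = w v u) (w_ge0 : forall u v, 0 <= w u v).
Implicit Types (r : rel T) (X Y : {set T}).

Definition edge_weight r X Y := \sum_(u in X) \sum_(v in Y) (r u v)%:R * w u v.

Lemma edge_weight_setC r X : symmetric r ->
  edge_weight r setT setT = edge_weight r X X + edge_weight r (~: X) (~: X) +
    (edge_weight r (~: X) X + edge_weight r (~: X) X).
Proof.
move=> rsym.
have sumC (F : T -> R) : \sum_(u in setT) F u = \sum_(u in X) F u + \sum_(u in ~: X) F u.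
  by rewrite (big_setID X) /= setTI setTD.
have crossC : edge_weight r X (~: X) = edge_weight r (~: X) X.
  rewrite /edge_weight exchange_big; apply: eq_bigr => u _; apply: eq_bigr => v _.
  by rewrite rsym w_sym.
rewrite -{1}crossC /edge_weight sumC; under eq_bigr do rewrite sumC.
under [X in _ + X = _]eq_bigr do rewrite sumC.
by rewrite !big_split /=; ring.
Qed.

Lemma edge_weight_leif_clique r r' X : irreflexive r -> irreflexive r' -> clique r' X ->
  edge_weight r X X <= edge_weight r' X X ?= iff
    [forall u in X, forall v in X, (u != v) ==> r u v || (w u v == 0)].
Proof.
move=> rirr r'irr cX; apply: leif_sum => u uX; apply: leif_sum => v vX.
have [<-|uv] /= := eqVneq u v; first by rewrite rirr r'irr; apply/leif_refl.
rewrite cX //; case: (r u v) => /=; first exact/leif_refl.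
rewrite mul0r mul1r eq_sym; exact: leif_eq.
Qed.

Variables (e : rel T) (H : {set T}) (a : T).
Hypotheses (esym : symmetric e) (eirr : irreflexive e) (aH : a \in H).
Hypothesis pend : pendant_outside e H.
Hypothesis w_hub : forall s v, v \in H -> w s v <= w s a.

Lemma sum_nbr_weights s :
  \sum_(v in H) (e s v)%:R * w s v = \sum_(v in [set v in H | e s v]) w s v.
Proof.
rewrite [RHS]big_mkcond [LHS]big_mkcond; apply: eq_bigr => v _; rewrite inE.
by case: (v \in H); case: (e s v); rewrite ?mul1r ?mul0r.
Qed.

Lemma sum_hub_weights s : s \notin H ->
  \sum_(v in H) (hub_adj a H s v)%:R * w s v = w s a.
Proof.
move=> sH; have sa : s != a by apply: contraNneq sH => ->.
rewrite (big_setD1 a) //= /hub_adj sa eqxx orbT mul1r big1 ?addr0 // => v.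
by rewrite !inE => /andP[/negPf va vH]; rewrite (negPf sa) va vH (negPf sH) andbF mul0r.
Qed.

Lemma sum_nbr_weights_le_hub s : s \notin H ->
  \sum_(v in H) (e s v)%:R * w s v <= \sum_(v in H) (hub_adj a H s v)%:R * w s v.
Proof.
move=> sH; rewrite sum_hub_weights // sum_nbr_weights.
apply: (@le_trans _ _ (\sum_(v in [set v in H | e s v]) w s a)).
  by apply: ler_sum => v; rewrite inE => /andP[vH _]; apply: w_hub.
have := pend sH; rewrite sumr_const /deg_in.
by case: #|_| => [|[|//]] _; rewrite ?mulr0n ?mulr1n.
Qed.

(* Each block of the sum is compared separately: a vertex outside H has at most one
   neighbour in H, and no edge weighs more than one that goes to a. *)
Lemma edge_weight_leif_hub : edge_weight e setT setT <= edge_weight (hub_adj a H) setT setT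
  ?= iff [&& [forall u in H, forall v in H, (u != v) ==> e u v || (w u v == 0)],
             [forall u in ~: H, forall v in ~: H, (u != v) ==> e u v || (w u v == 0)] &
             [forall s in ~: H, \sum_(v in H) (e s v)%:R * w s v == w s a]].
Proof.
have hirr := @hub_adj_irr _ a H.
have cross : edge_weight e (~: H) H <= edge_weight (hub_adj a H) (~: H) H
    ?= iff [forall s in ~: H, \sum_(v in H) (e s v)%:R * w s v == w s a].
  apply: leif_sum => s; rewrite inE => sH; rewrite -(sum_hub_weights sH).
  exact/leif_eq/sum_nbr_weights_le_hub.
rewrite !(@edge_weight_setC _ H) //; last exact: hub_adj_sym.
rewrite andbA -[X in _ && X]andbb; apply: leifD; last exact: leifD.
apply: leifD; apply: edge_weight_leif_clique => // u v.
  by move=> uH vH uv; rewrite hub_adj_same_side ?uH ?vH.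
by rewrite !inE => /negPf uH /negPf vH uv; rewrite hub_adj_same_side ?uH ?vH.
Qed.

Lemma edge_weight_eq_hub : (forall u v, 0 < w u v) ->
    edge_weight e setT setT = edge_weight (hub_adj a H) setT setT ->
  [/\ clique e H, clique e (~: H) & forall s, s \notin H -> exists2 v, v \in H & e s v].
Proof.
move=> w_gt0 /eqP; rewrite edge_weight_leif_hub => /and3P[cH cS nbr].
have cliqueP X : [forall u in X, forall v in X, (u != v) ==> e u v || (w u v == 0)] ->
    clique e X.
  move=> /forall_inP cX u v uX vX uv; have /forall_inP/(_ v vX) := cX u uX.
  by rewrite uv (gt_eqF (w_gt0 u v)) orbF.
split; [exact: cliqueP|exact: cliqueP|move=> s sH].
have := forall_inP nbr s; rewrite inE => /(_ sH); rewrite sum_nbr_weights.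
have [->|[v]] := set_0Vmem [set v in H | e s v].
  by rewrite big_set0 eq_sym gt_eqF.
by rewrite inE => /andP[vH sv]; exists v.
Qed.

End EdgeWeights.

Section HubComparison.
Variables (R : realDomainType) (T : finType) (b : R) (x : T -> R).
Hypotheses (b_ge0 : 0 <= b) (x_ge0 : forall u, 0 <= x u).
Implicit Type r : rel T.

Definition edge_form u v : R := 2 * (x u * x v) + b * (x u ^+ 2 + x v ^+ 2).

Lemma edge_form_sym u v : edge_form u v = edge_form v u.
Proof. by rewrite /edge_form; ring. Qed.

Lemma edge_form_ge0 u v : 0 <= edge_form u v.
Proof. by rewrite addr_ge0 ?mulr_ge0 ?addr_ge0 ?sqr_ge0. Qed.

Lemma edge_form_le u v v' : x v <= x v' -> edge_form u v <= edge_form u v'.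
Proof.
move=> vv'; rewrite /edge_form lerD // ?ler_wpM2l //.
by rewrite lerD2l ler_sqr ?nnegrE.
Qed.

Lemma adjdeg_form_edges r : symmetric r ->
  2 * adjdeg_form r b x = edge_weight edge_form r setT setT.
Proof.
move=> rsym; have formE : adjdeg_form r b x =
    \sum_u \sum_v (r u v)%:R * (x u * x v + b * x u ^+ 2).
  by apply: eq_bigr => u _; rewrite mulr_sumr; apply: eq_bigr => v _; ring.
have -> : 2 * adjdeg_form r b x = adjdeg_form r b x + adjdeg_form r b x by ring.
rewrite {2}formE exchange_big /= formE -big_split /edge_weight.
apply: eq_big => [u|u _]; first by rewrite inE.
rewrite -big_split; apply: eq_big => [v|v _]; first by rewrite inE.
by rewrite /= rsym /edge_form; ring.
Qed.

Variables (e : rel T) (H : {set T}) (a : T).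
Hypotheses (esym : symmetric e) (eirr : irreflexive e) (aH : a \in H).
Hypothesis pend : pendant_outside e H.
Hypothesis amax : forall v, v \in H -> x v <= x a.

Let form_hub s v : v \in H -> edge_form s v <= edge_form s a.
Proof. by move=> vH; apply/edge_form_le/amax. Qed.

Lemma adjdeg_form_le_hub : adjdeg_form e b x <= adjdeg_form (hub_adj a H) b x.
Proof.
rewrite -(@ler_pM2l _ 2) // !adjdeg_form_edges //; last exact: hub_adj_sym.
by rewrite (edge_weight_leif_hub edge_form_sym edge_form_ge0 esym eirr aH pend form_hub).
Qed.

Lemma adjdeg_form_eq_hub : (forall u, 0 < x u) ->
    adjdeg_form e b x = adjdeg_form (hub_adj a H) b x ->
  [/\ clique e H, clique e (~: H) & forall s, s \notin H -> exists2 v, v \in H & e s v].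
Proof.
move=> x_gt0 /(congr1 ( *%R 2)); rewrite !adjdeg_form_edges //; last exact: hub_adj_sym.
apply: (edge_weight_eq_hub edge_form_sym edge_form_ge0 esym eirr aH pend form_hub) => u v.
by rewrite ltr_pwDl ?mulr_gt0 // mulr_ge0 ?addr_ge0 ?sqr_ge0.
Qed.

End HubComparison.

Lemma hub_eigenfun_gt0 (R : realType) (b l : R) (T : finType) (a : T) (H : {set T})
    (x : T -> R) : (forall u, 0 <= x u) ->
  @adjdeg_eigenfun R b (hub_graph a H) l x -> forall u, 0 < x u.
Proof.
move=> x0 [[u1 xu1] xE].
have nbr u v : x u = 0 -> hub_adj a H u v -> x v = 0.
  move=> xu uv; have := xE u; rewrite /adjdeg_op xu !mulr0.
  under eq_bigr do rewrite addr0.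
  move/psumr_eq0P => /(_ (fun y _ => mulr_ge0 (ler0n _ _) (x0 y)) v isT).
  by rewrite /= uv mul1r.
have xa : x a != 0.
  apply: contraNneq xu1 => xa; have [->|ua] := eqVneq u1 a; first exact/eqP.
  by apply/eqP/(nbr a) => //; rewrite /hub_adj eq_sym ua eqxx.
move=> u; rewrite lt_def x0 andbT; apply: contraNneq xa => xu.
have [<-|ua] := eqVneq u a; first exact/eqP.
by apply/eqP/(nbr u) => //; rewrite /hub_adj ua eqxx orbT.
Qed.

Section PendantOutside.
Variables (R : realType) (b : R) (k : nat) (G : sgraph) (H : {set G}).
Hypotheses (b_ge0 : 0 <= b) (kG : (k < #|G|)%N).
Hypotheses (cardH : #|H| = (#|G| - k)%N) (pend : pendant_outside (@adj G) H).

Lemma hub_graph_iso_Lgraph a : a \in H -> sgraph_iso (hub_graph a H) (Lgraph #|G| k).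
Proof.
move=> aH; have [a' [H' [aH' cH'] adjL]] := Lgraph_hub kG.
by apply: (@hub_iso (hub_graph a H) _ a a' H H') => //; rewrite ?card_Lgraph ?cH'.
Qed.

(* A nonnegative top eigenvector of G is also one of the hub graph at the vertex of H
   where it is largest. *)
Theorem pendant_outside_extremal : adjdeg_radius b (Lgraph #|G| k) <= adjdeg_radius b G ->
  [/\ clique (@adj G) H, clique (@adj G) (~: H)
    & forall s, s \notin H -> exists2 v, v \in H & adj s v].
Proof.
move=> LG; have [|x [x_neq0 xE] x_ge0] := @exists_nonneg_eigenfun R b G; first by lia.
have /card_gt0P[h hH] : (0 < #|H|)%N by rewrite cardH; lia.
have [a aH amax] := Order.TotalTheory.arg_maxP (P := mem H) x hH.
rewrite -(adjdeg_radius_iso b (hub_graph_iso_Lgraph aH)) in LG.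
have formG : adjdeg_form (@adj G) b x = adjdeg_radius b G * \sum_u x u ^+ 2.
  by rewrite mulr_sumr; apply: eq_bigr => u _; rewrite xE; ring.
have hub_ge := adjdeg_form_le_hub b_ge0 x_ge0 (@adj_sym G) (@adj_irr G) aH pend amax.
have hub_le := @adjdeg_form_le R b (hub_graph a H) x.
have LGx : adjdeg_radius b (hub_graph a H) * \sum_u x u ^+ 2 <=
    adjdeg_radius b G * \sum_u x u ^+ 2.
  by rewrite ler_wpM2r // sumr_ge0 // => u _; apply: sqr_ge0.
have hubE : adjdeg_form (hub_adj a H) b x = adjdeg_form (@adj G) b x.
  by apply: le_anti; rewrite hub_ge formG (le_trans hub_le LGx).
have hubL : adjdeg_form (hub_adj a H) b x =
    adjdeg_radius b (hub_graph a H) * \sum_u x u ^+ 2.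
  by apply: le_anti; rewrite hub_le hubE formG LGx.
apply: (adjdeg_form_eq_hub b_ge0 x_ge0 (@adj_sym G) (@adj_irr G) aH pend amax) => //.
have xL := @adjdeg_form_eq R b (hub_graph a H) x hubL.
exact: (@hub_eigenfun_gt0 R b _ G a H x x_ge0 (conj x_neq0 xL)).
Qed.

End PendantOutside.

(** * Two cliques joined by pendant edges *)

Section TwoCliques.
Variables (T : finType) (e : rel T) (H : {set T}).
Hypotheses (esym : symmetric e) (eirr : irreflexive e).
Hypotheses (cliqueH : clique e H) (cliqueS : clique e (~: H)).

Lemma clique_cycles (X : {set T}) l : clique e X -> (2 < l <= #|X|)%N -> has_ucycle e l.
Proof.
move=> cX /andP[l2 /exists_subset_card[B /subsetP BX cB]].
have [||q cq qB] := @clique_spanning_cycle _ e B; first by lia.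
  by move=> x y /BX xX /BX yX; apply: cX.
by exists q; rewrite // -cB -(eq_card qB) (card_uniqP (ucycle_uniq cq)).
Qed.

Lemma two_crossing_edges_cycles s t c d l : s \notin H -> t \notin H -> s != t ->
    c \in H -> d \in H -> c != d -> e t c -> e s d -> (3 < l <= #|H| + 2)%N ->
  has_ucycle e l.
Proof.
move=> sH tH st cH dH cd tc sd lH.
have [|B BH cB] := @exists_subset_card _ (H :\ c :\ d) (l - 4).
  have := cardsD1 c H; have := cardsD1 d (H :\ c).
  by rewrite !inE eq_sym cd cH dH /=; lia.
have {}BH x : x \in B -> [/\ x \in H, x != c & x != d].
  by move/(subsetP BH); rewrite !inE => /and3P[].
pose q := c :: rcons (enum B) d.
have qH x : x \in q -> x \in H.
  by rewrite inE mem_rcons inE mem_enum => /or3P[/eqP->|/eqP->|/BH[]].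
have uq : uniq q.
  rewrite /= mem_rcons inE (negPf cd) mem_enum rcons_uniq mem_enum enum_uniq andbT.
  by apply/andP; split; apply/negP => /BH[]; rewrite eqxx.
have cq : cycle e q.
  apply: complete_cycle => //=; first by rewrite size_rcons.
  by move=> x y xq yq; apply: cliqueH; apply: qH.
have notq y : y \notin H -> y \notin q by apply/contraNN/qH.
exists [:: s, t & q]; last by rewrite /= size_rcons -cardE; lia.
rewrite /ucycle cons_uniq inE negb_or st notq // cons_uniq notq // uq !andbT /=.
move: cq; rewrite /= rcons_path => /andP[pq _].
by rewrite tc rcons_path pq last_rcons [e d s]esym sd /= andbT cliqueS ?inE.
Qed.

Hypothesis pend : pendant_outside e H.

Lemma common_nbr_hub_adj d : d \in H -> {in ~: H, forall s, e s d} -> e =2 hub_adj d H.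
Proof.
move=> dH nbr_d; have cross u v : u \in H -> v \notin H -> e u v = hub_adj d H u v.
  move=> uH vH; have vd : e v d by apply: nbr_d; rewrite inE.
  have uv : u != v by apply: contraNneq vH => <-.
  have /negPf v_ne_d : v != d by apply: contraNneq vH => ->.
  rewrite /hub_adj uv uH (negPf vH) v_ne_d !orbF esym.
  have [->|ud] := eqVneq u d; first exact: vd.
  apply: contraTF (pend vH) => vu; rewrite -ltnNge; apply/card_gt1P.
  by exists u, d; rewrite !inE uH dH vu vd.
move=> u v; have [<-|uv] := eqVneq u v; first by rewrite eirr hub_adj_irr.
have [uH|uH] := boolP (u \in H); have [vH|vH] := boolP (v \in H).
- by rewrite cliqueH // hub_adj_same_side // uH vH.
- exact: cross.
- by rewrite esym hub_adj_sym cross.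
- by rewrite cliqueS ?inE // hub_adj_same_side // (negPf uH) (negPf vH).
Qed.

Lemma two_cliques_cycles_or_hub s0 : s0 \notin H -> (2 < #|H|)%N ->
    (forall s, s \notin H -> exists2 v, v \in H & e s v) ->
  (forall l, (3 <= l <= #|H| + 1)%N -> has_ucycle e l) \/
  exists2 d, d \in H & e =2 hub_adj d H.
Proof.
move=> sH H3 nbr; have [d dH sd] := nbr s0 sH.
have [/forall_inP all_d|] := boolP [forall t in ~: H, e t d].
  by right; exists d => //; apply: common_nbr_hub_adj.
rewrite negb_forall_in => /exists_inP[t]; rewrite inE => tH ntd.
left=> l lH; have [l3|l3] := leqP l #|H|; first by apply: (clique_cycles cliqueH); lia.
have [c cH tc] := nbr t tH.
have cd : c != d by apply: contraNneq ntd => <-.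
have st : s0 != t by apply: contraNneq ntd => <-.
by apply: (two_crossing_edges_cycles sH tH st cH dH cd tc sd); lia.
Qed.

End TwoCliques.

Theorem pendant_outside_cycles_or_iso (R : realType) (b : R) (k : nat) (G : sgraph)
    (H : {set G}) : 0 <= b -> (0 < k)%N -> (k + 3 <= #|G|)%N ->
    adjdeg_radius b (Lgraph #|G| k) <= adjdeg_radius b G ->
    #|H| = (#|G| - k)%N -> pendant_outside (@adj G) H ->
  (forall l, (3 <= l <= #|G| - k + 1)%N -> has_cycle G l) \/
  sgraph_iso G (Lgraph #|G| k).
Proof.
move=> b0 k0 kG LG cH pend; have kn : (k < #|G|)%N by lia.
have [cliqueH cliqueS nbr] := pendant_outside_extremal b0 kn cH pend LG.
have /card_gt0P[s] : (0 < #|~: H|)%N by have := cardsC H; lia.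
rewrite inE => sH; have H3 : (2 < #|H|)%N by lia.
have [cyc|[d dH hub]] := two_cliques_cycles_or_hub (@adj_sym G) (@adj_irr G)
  cliqueH cliqueS pend sH H3 nbr.
  by left; rewrite -cH.
right; have [a [H' [aH' cH'] adjL]] := Lgraph_hub kn.
by apply: (hub_iso hub adjL) => //; rewrite ?card_Lgraph ?cH'.
Qed.

Local Close Scope ring_scope.

Theorem theorem1p7 (R : realType) (k n : nat) (G : sgraph)
    (k_ge1 : 1 <= k) (order_G : #|G| = n)
    (hyp :
      ((spectral_radius R (Lgraph n k) <= spectral_radius R G)%R /\
         maxn (6 * k + 11) ((k + 3) * (k + 4) %/ 2) <= n) \/
      ((signless_spectral_radius R (Lgraph n k)
          <= signless_spectral_radius R G)%R /\
         maxn (6 * k + 11) (k ^ 2 + 2 * k + 3) <= n)) :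
  (forall l : nat, 3 <= l <= n - k + 1 -> has_cycle G l) \/
  sgraph_iso G (Lgraph n k).
Proof.
subst n.
have [b [b_ge0 LG few n_ge]] : exists b : R, [/\ (0 <= b)%R,
    (adjdeg_radius b (Lgraph #|G| k) <= adjdeg_radius b G)%R,
    pairs (nonadj (@adj G)) setT setT + 3 <= 2 * ((k + 1) * (#|G| - k - 2))
    & 6 * k + 11 <= #|G|].
  case: hyp => -[LG]; rewrite geq_max => /andP[n_ge n_ge_k]; have kn : k + 2 <= #|G| by lia.
    exists 0%R; rewrite -!spectral_radiusE; split=> //.
    exact: spectral_radius_few_nonadj LG n_ge_k.
  exists 1%R; rewrite -!signless_spectral_radiusE; split=> //.
  exact: signless_spectral_radius_few_nonadj LG n_ge_k.
have [|[H cH pend]] :=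
    pancyclic_or_pendant_outside (@adj_sym G) (@adj_irr G) erefl k_ge1 n_ge few.
  by left.
by apply: pendant_outside_cycles_or_iso b_ge0 _ _ LG cH pend => //; lia.
Qed.
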